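(* Suppose $G$ satisfies Assumption 3.1 (stated in the context). Then the estimator $$\hat h_n=\frac{2\sum_{t=1}^n\mathbf{1}\{\Delta X_t<0\}}{g(0)\mu_G}$$ is an efficient estimator of $h$ in the sequence of experiments $(\mathcal{E}_n(G))_{n\in\mathbb{N}}$; that is, for every $h\ge0$ the law of $\hat h_n$ under $\mathbb{P}_{1-h/n^2}$ converges weakly to a probability distribution $Z_h$ on $\mathbb{R}$ with $\int z\,\mathrm{d}Z_h(z)=h$ and $\int(z-h)^2\,\mathrm{d}Z_h(z)=\frac{2h}{g(0)\mu_G}$.
   Context: Notation: $\mathbb{N}=\{1,2,\ldots\}$, $\mathbb{Z}_+=\mathbb{N}\cup\{0\}$. $G$ is a (known) probability distribution on $\mathbb{Z}_+$ with probability mass function $g$, mean $\mu_G$ and variance $\sigma_G^2$. For $\theta\in[0,1]$, under $\mathbb{P}_\theta=\mathbb{P}_{\theta,G}$ the INAR(1) process $(X_t)_{t\ge0}$ is defined by $X_0=0$ and $X_t=\vartheta\circ X_{t-1}+\varepsilon_t$ for $t\in\mathbb{N}$, where $\vartheta\circ X_{t-1}=\sum_{j=1}^{X_{t-1}}Z^{(t)}_j$ (an empty sum is $0$), $(Z^{(t)}_j)_{j,t\in\mathbb{N}}$ are i.i.d. Bernoulli variables with success probability $\theta$, and, independently of these, $(\varepsilon_t)_{t\in\mathbb{N}}$ are i.i.d. with distribution $G$. $\Delta X_t=X_t-X_{t-1}$. $\mathbb{P}^{(n)}_\theta$ is the law of $(X_0,\ldots,X_n)$ under $\mathbb{P}_\theta$,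 and $\mathcal{E}_n(G)=\bigl(\mathbb{Z}_+^{n+1},2^{\mathbb{Z}_+^{n+1}},(\mathbb{P}^{(n)}_{1-h/n^2}\mid h\ge0)\bigr)$, where for fixed $h$ one considers $n$ large enough that $1-h/n^2\in[0,1]$. Efficiency: among sequences of estimators $T_n=T_n(X_0,\dots,X_n)$ whose laws under $\mathbb{P}_{1-h/n^2}$ converge weakly, for every $h\ge0$, to some $Z_h$ with $\int z\,\mathrm{d}Z_h(z)=h$, an estimator is called efficient if its limit laws attain the variance lower bound $\int(z-h)^2\,\mathrm{d}Z_h(z)\ge 2h/(g(0)\mu_G)$ with equality for all $h\ge0$. Assumption 3.1 on $G$: one of the following holds: (1) the support of $G$ is $\{0,\ldots,M\}$ for some $M\in\mathbb{N}$; (2) the support of $G$ is $\mathbb{Z}_+$, $\sigma_G^2<\infty$, and $g$ is eventually decreasing, i.e. there is $M\in\mathbb{N}$ with $g(k+1)\le g(k)$ for all $k\ge M$. *)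

(* Defs.v *)
From HB Require Import structures.
From mathcomp Require Import all_boot all_order all_algebra.
From mathcomp Require Import finmap.
From mathcomp Require Import all_classical all_reals all_analysis.
From mathcomp Require Import measurable_realfun.

Set Implicit Arguments.
Unset Strict Implicit.
Unset Printing Implicit Defensive.

Import Order.TTheory GRing.Theory Num.Theory.
Import numFieldNormedType.Exports.

Local Open Scope classical_set_scope.
Local Open Scope ring_scope.

Section independence.
Context d (T : measurableType d) (R : realType) (P : probability T R).

Definition mutually_independent d' (S : measurableType d') (I : choiceType)
    (X : I -> T -> S) : Prop :=
  forall (J : {fset I}) (A : I -> set S), (forall i, measurable (A i)) ->
    P (\bigcap_(i in [set` J]) X i @^-1` A i)
    = (\prod_(i <- J) P (X i @^-1` A i))%E.

Definition sigma_of d' (S : measurableType d') (I : Type) (X : I -> T -> S) :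
    set (set T) :=
  <<s \bigcup_i preimage_set_system setT (X i) measurable >>.

Definition independent_systems (F G : set (set T)) : Prop :=
  forall A B, F A -> G B -> P (A `&` B) = (P A * P B)%E.

End independence.

(* Weak convergence, tested against bounded continuous functions. *)
Definition weakly_converges (R : realType) (mu : nat -> probability R R)
    (nu : probability R R) : Prop :=
  forall f : R -> R, continuous f -> bounded_fun f ->
    ('E_(mu n)[f] @[n --> \oo] --> 'E_nu[f])%E.

Section immigration_law.
Context (R : realType) (G : probability nat R).

Definition mass (k : nat) : R := fine (G [set k]).

Definition supp : set nat := [set k | 0 < mass k].

Definition mu_G : \bar R := ('E_G[fun k => k%:R])%E.

Definition sigma2_G : \bar R := ('V_G[fun k => k%:R])%E.

Definition assumption_G : Prop :=
  (exists2 M : nat, (0 < M)%N & supp = [set k | (k <= M)%N])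
  \/ [/\ supp = setT,
         (sigma2_G < +oo)%E
       & exists2 M : nat, (0 < M)%N &
           forall k, (M <= k)%N -> mass k.+1 <= mass k].

End immigration_law.

Section inar.
Context d (Omega : measurableType d).
Variables (Z : nat -> nat -> {mfun Omega >-> bool})
  (eps : nat -> {mfun Omega >-> nat}).

(* Indices start at 0: [Z t j] and [eps t] stand for Z^(t+1)_(j+1) and
   eps_(t+1). *)
Fixpoint inar (t : nat) (w : Omega) : nat :=
  if t is s.+1 then (\sum_(j < inar s w) Z s j w + eps s w)%N else 0%N.

Lemma measurable_inar t : measurable_fun setT (inar t).
Proof.
have mcase d' (S : measurableType d') (N : Omega -> nat)
    (F : nat -> Omega -> S) : measurable_fun setT N ->
    (forall m, measurable_fun setT (F m)) ->
    measurable_fun setT (fun w => F (N w) w).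
  move=> mN mF _ Y mY; rewrite setTI.
  rewrite (_ : _ @^-1` Y = \bigcup_m (N @^-1` [set m] `&` F m @^-1` Y)).
    apply: bigcup_measurable => m _; apply: measurableI.
      by rewrite -[X in measurable X]setTI; exact: mN.
    by rewrite -[X in measurable X]setTI; exact: mF.
  by apply/seteqP; split=> [w Yw|w [m _ [/= -> //]]]; exists (N w).
have mD (f g : Omega -> nat) : measurable_fun setT f -> measurable_fun setT g ->
    measurable_fun setT (fun w => (f w + g w)%N).
  move=> mf mg; apply: (mcase _ _ f (fun m w => (m + g w)%N)) => // m.
  by apply: (@measurableT_comp _ _ _ _ _ _ (addn m)) => //.
elim: t => [|t IH] /=; first exact: measurable_cst.
apply: (mD) => //.
apply: (mcase _ _ (inar t) (fun m w => (\sum_(j < m) Z t j w)%N)) => // m.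
elim: m => [|m IHm].
  by under eq_fun do rewrite big_ord0; exact: measurable_cst.
under eq_fun do rewrite big_ord_recr /=.
by apply: (mD) => //; exact: (@measurableT_comp _ _ _ _ _ _ nat_of_bool).
Qed.

Definition inar_path (n : nat) (w : Omega) : n.+1.-tuple nat :=
  [tuple inar i w | i < n.+1].

Lemma measurable_inar_path n : measurable_fun setT (inar_path n).
Proof.
apply/measurable_fun_tnthP => i.
rewrite (_ : _ \o _ = inar i); first exact: measurable_inar.
by apply/funext => w /=; rewrite tnth_mktuple.
Qed.

HB.instance Definition _ n :=
  isMeasurableFun.Build _ _ _ _ (inar_path n) (@measurable_inar_path n).

Definition inar_innovations (R : realType) (P : probability Omega R)
    (G : probability nat R) (theta : R) : Prop :=
  [/\ forall t j, distribution P (Z t j) = bernoulli_prob theta,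
      mutually_independent P (fun tj : nat * nat => Z tj.1 tj.2),
      forall t, distribution P (eps t) = G,
      mutually_independent P eps
    & independent_systems P
        (sigma_of (fun tj : nat * nat => Z tj.1 tj.2)) (sigma_of eps)].

(* Only meaningful for n so large that 1 - h / n^2 lies in [0, 1]. *)
Definition inar_experiment (R : realType) (P : R -> probability Omega R)
    (n : nat) (h : R) : probability (n.+1.-tuple nat) R :=
  distribution (P (1 - h / n%:R ^+ 2)) (inar_path n).

End inar.

Section estimation.
Context (R : realType) (G : probability nat R).

(* [x_(t+1) < x_t] is the event Delta x_(t+1) < 0; the subtraction of nat is
   truncated. *)
Definition hhat (n : nat) (x : n.+1.-tuple nat) : R :=
  2 * (\sum_(t < n) (nth 0%N x t.+1 < nth 0%N x t)%N%:R)
  / (mass G 0%N * fine (mu_G G)).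

Lemma measurable_hhat n : measurable_fun setT (@hhat n).
Proof.
apply: measurable_funM => //; apply: measurable_funM => //.
apply: measurable_sum => t.
apply: (@measurableT_comp _ _ _ _ _ _ (fun b : bool => b%:R : R)) => //.
have m i : (i < n.+1)%N ->
    measurable_fun setT (fun x : n.+1.-tuple nat => nth 0%N x i).
  move=> ilt; rewrite (_ : (fun _ => _) = @tnth _ nat ^~ (Ordinal ilt)).
    exact: measurable_tnth.
  by apply/funext => x; rewrite (tnth_nth 0%N).
by apply: measurable_fun_ltn; apply: m => //; rewrite ltnS // ltnW.
Qed.

HB.instance Definition _ n :=
  isMeasurableFun.Build _ _ _ _ (@hhat n) (@measurable_hhat n).

(* 2 h / (g(0) mu_G) is the lower bound on the variance of the limit laws of
   estimators of h whose limit laws have mean h. *)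
Definition efficient (E : forall n, R -> probability (n.+1.-tuple nat) R)
    (T : forall n, {mfun n.+1.-tuple nat >-> R}) : Prop :=
  exists Zlim : R -> probability R R, forall h : R, 0 <= h ->
    [/\ weakly_converges (fun n => distribution (E n h) (T n)) (Zlim h),
        (\int[Zlim h]_z z%:E)%E = h%:E
      & (\int[Zlim h]_z ((z - h) ^+ 2)%:E)%E
        = (2 * h / (mass G 0%N * fine (mu_G G)))%:E].

End estimation.

(* Main.v *)
Require Import Defs.
From HB Require Import structures.
From mathcomp Require Import all_boot all_order all_algebra finmap.
From mathcomp Require Import all_classical all_reals all_analysis.
From mathcomp Require Import measurable_realfun.
From mathcomp Require Import ring lra zify.

Set Implicit Arguments.
Unset Strict Implicit.
Unset Printing Implicit Defensive.

Import Order.TTheory GRing.Theory Num.Theory.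
Import numFieldNormedType.Exports.

Local Open Scope classical_set_scope.
Local Open Scope ring_scope.

(** Put q = h / n^2, the death probability of an individual in one step, and
let S_t be the number of immigrants before time t, the size that the population
would have without deaths. As S_t is about mu t, only about q mu n^2 / 2 deaths
occur up to time n, so that the law of rare events applies. The path goes down
at time t when, essentially, an individual dies and nobody immigrates; the
expected number of such deaths is close to lam = g(0) mu h / 2. The number of
drops therefore converges in law to a Poisson variable of parameter lam, and
hhat converges to c = 2 / (g(0) mu) times this variable, which has mean
c lam = h and variance c^2 lam = c h, as efficiency requires.

To make this precise, attach a survival mark to every cell (t, j) with j < S_t,
whether or not the population at time t reaches j. Once the immigration is
fixed, the cells form a deterministic set, and the number of failed marks at the
idle times, those without immigration, is exactly binomial. It agrees with the
number of drops (drops_deaths) unless two marks fail at the same time, or more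
than K marks fail in all, or one of the K last marks of some time fails; these
events have probability at most of order 1 / n, 1 / K and K / n
(integral_exceptional_bound).

Independence of marks and immigration turns the law of the failures at idle
times into an average of binomial laws (freezing, probability_idle_deaths). The
number V of idle cells differs from g(0) mu n^2 / 2 by O(n^(3/2)) in mean
(integral_size_idle_cells_deviation), hence q V tends to lam in mean. The
binomial weights b_k satisfy (k + 1) b_(k+1) = lam b_k up to an error governed
by |q V - lam| and q (binomial_pmf_chen_stein). This relation passes to the
average, where V enters linearly, and together with the limit at k = 0 it
determines the Poisson limit (poisson_pmf_cvg). Convergence of the weights on
the natural numbers gives weak convergence (pmf_cvg_bounded_integral). *)

(** * Integrals and probabilities *)

Lemma ge0_integral_nat_valued d (T : measurableType d) (R : realType)
    (m : {measure set T -> \bar R}) (tau : T -> nat) (f : nat -> \bar R) :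
  (forall k, measurable (tau @^-1` [set k])) -> (forall k, 0 <= f k)%E ->
  (\int[m]_w f (tau w) = \sum_(0 <= k <oo) f k * m (tau @^-1` [set k]))%E.
Proof.
move=> mtau f0.
have cupE : setT = \bigcup_k (tau @^-1` [set k]).
  by apply/seteqP; split=> // w _; exists (tau w).
have ftauE k : {in tau @^-1` [set k], (fun w => f (tau w)) =1 cst (f k)}.
  by move=> w; rewrite inE /= => ->.
rewrite cupE ge0_integral_bigcup//.
- apply: eq_eseriesr => k _.
  by rewrite (eq_integral (cst (f k))) ?integral_cst// => w; exact: ftauE.
- apply/measurable_fun_bigcup => // k.
  apply: (eq_measurable_fun (cst (f k))) => [w wk|]; first by rewrite (ftauE k).
  exact: measurable_cst.
- by move=> j k _ _ [w [/= <- <-]].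
Qed.

Lemma integral_probability_cst d (T : measurableType d) (R : realType)
    (P : probability T R) (r : R) : (\int[P]_w r%:E = r%:E)%E.
Proof. by rewrite integral_cst//= probability_setT mule1. Qed.

Lemma bounded_integrable d (T : measurableType d) (R : realType)
    (P : probability T R)
    (g : T -> R) (M : R) (D : set T) : measurable D -> measurable_fun setT g ->
  (forall k, `|g k| <= M) -> P.-integrable D (EFin \o g).
Proof.
move=> mD mg gM; apply: measurable_bounded_integrable => //.
- by rewrite (le_lt_trans (probability_le1 P mD)) ?ltry.
- exact: measurable_funTS.
- exists M; split; first exact: num_real.
  by move=> x Mx k _; exact/(le_trans (gM k))/ltW.
Qed.

(** The bound on the integral of g is stated in the extended reals, so that
    g may be unbounded and needs no proof of integrability. *)
Lemma normr_Rintegral_le d (T : measurableType d) (R : realType)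
    (P : probability T R) (f g : T -> R) (M b : R) :
  measurable_fun setT f -> measurable_fun setT g ->
  (forall w, `|f w| <= M) -> (forall w, `|f w| <= g w) ->
  (\int[P]_w (g w)%:E <= b%:E)%E -> `|\int[P]_w f w| <= b.
Proof.
move=> mf mg fM fg gb.
have intf : P.-integrable setT (EFin \o f) by exact: bounded_integrable fM.
apply: le_trans (le_normr_Rintegral _ intf) _ => //.
have fin : (\int[P]_w `|f w|%:E)%E \is a fin_num.
  apply: (integrable_fin_num measurableT).
  apply: (@bounded_integrable _ _ _ _ _ M) => //; first exact: measurableT_comp.
  by move=> w; rewrite normr_id.
rewrite -lee_fin /Rintegral fineK//; apply: le_trans gb.
apply: ge0_le_integral => //.
- by apply/measurable_EFinP; exact: measurableT_comp.
- exact/measurable_EFinP.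
- by move=> w _; rewrite lee_fin.
Qed.

Section bounded_expectation.
Context d (T : measurableType d) (R : realType) (P : probability T R).

Lemma expectation_bounded (f : T -> R) (M : R) : measurable_fun setT f ->
  (forall x, `|f x| <= M) -> ('E_P[f] = (\int[P]_x f x)%:E)%E.
Proof.
move=> mf fM; rewrite unlock /Rintegral fineK//.
by apply: (integrable_fin_num measurableT); exact: bounded_integrable fM.
Qed.

Lemma Rintegral_distribution d' (T' : measurableType d') (X : {mfun T >-> T'})
    (f : T' -> R) (M : R) : measurable_fun setT f -> (forall x, `|f x| <= M) ->
  \int[distribution P X]_y f y = \int[P]_x f (X x).
Proof.
move=> mf fM; rewrite /Rintegral integral_distribution//.
  exact/measurable_EFinP.
apply: (@bounded_integrable _ _ _ _ _ M) => //.
exact: (measurableT_comp mf (measurable_funPT X)).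
Qed.

End bounded_expectation.

Section union_bound.
Context d (Omega : measurableType d) (R : realType) (P : probability Omega R).

Lemma measurable_exists (T : finType) (Q : T -> Omega -> bool) :
  (forall t, measurable [set w | Q t w]) ->
  measurable [set w | [exists t, Q t w]].
Proof.
move=> mQ; rewrite (_ : [set w | _] = \bigcup_(t in [set: T]) [set w | Q t w]).
  by apply: fin_bigcup_measurable => // t _; exact: mQ.
by apply/seteqP; split=> w /= => [/existsP[t Qt]|[t _ Qt]];
  [exists t|apply/existsP; exists t].
Qed.

Lemma probability_exists (T : finType) (Q : T -> Omega -> bool) :
  (forall t, measurable [set w | Q t w]) ->
  (P [set w | [exists t, Q t w]] <= \sum_(t : T) P [set w | Q t w])%E.
Proof.
move=> mQ.
rewrite (_ : [set w | _] = \big[setU/set0]_(t : T) [set w | Q t w]).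
  elim: (index_enum T) => [|t s IH]; first by rewrite !big_nil measure0.
  rewrite !big_cons; apply: le_trans (measureU2 _ _ _) _ => //.
    by apply: bigsetU_measurable => *; exact: mQ.
  by rewrite leeD2l.
rewrite -bigcup_seq; apply/seteqP; split=> w /= => [/existsP[t Qt]|[t _ Qt]].
  by exists t => //=; rewrite mem_index_enum.
by apply/existsP; exists t.
Qed.

(** The coupling inequality: outside B the two variables coincide. *)
Lemma probability_change_of_variable (M N : Omega -> nat) (B : set Omega) k :
  measurable (M @^-1` [set k]) -> measurable (N @^-1` [set k]) -> measurable B ->
  (forall w, ~ B w -> M w = N w) ->
  `|fine (P (M @^-1` [set k])) - fine (P (N @^-1` [set k]))| <= fine (P B).
Proof.
move=> mM mN mB MN.
have half (M' N' : Omega -> nat) : measurable (M' @^-1` [set k]) ->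
    measurable (N' @^-1` [set k]) -> (forall w, ~ B w -> M' w = N' w) ->
    fine (P (M' @^-1` [set k])) <= fine (P (N' @^-1` [set k])) + fine (P B).
  move=> mM' mN' MN'.
  rewrite -fineD ?fin_num_measure// fine_le ?fin_numD ?fin_num_measure//.
  apply: le_trans (measureU2 _ mN' mB); apply: le_measure.
  - by rewrite inE.
  - by rewrite inE; exact: measurableU.
  by move=> w /= <-; case: (pselect (B w)) => Bw; [right|left; rewrite MN'].
have := half M N mM mN MN.
have := half N M mN mM (fun w Bw => esym (MN w Bw)).
by rewrite ler_norml; lra.
Qed.

End union_bound.

(** * The Poisson law *)

Section poisson.
Context {R : realType}.

Lemma poisson_prob1 (rate : R) k j : 0 <= rate ->
  poisson_prob rate k [set j] = (rate ^+ j / j`!%:R * expR (- rate))%:E.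
Proof.
rewrite le_eqVlt /poisson_prob => /predU1P[<-|rate0].
  rewrite ltxx diracE in_set1 oppr0 expR0 mulr1 expr0n eq_sym.
  by case: eqP => [->|_] /=; rewrite ?fact0 ?divr1// mul0r.
by rewrite rate0 esum_set1 ?lee_fin ?poisson_pmf_ge0// /poisson_pmf rate0.
Qed.

(** The weights p_k of the law satisfy (k + 1) p_(k+1) = rate p_k; summing
    against f yields an identity from which all moments follow. *)
Lemma poisson_chen_stein (rate : R) j (f : nat -> \bar R) : 0 <= rate ->
  (forall k, 0 <= f k)%E ->
  (\int[poisson_prob rate j]_k (k%:R%:E * f k)
   = rate%:E * \int[poisson_prob rate j]_k f k.+1)%E.
Proof.
move=> rate0 f0.
have mid k : measurable ((id : nat -> nat) @^-1` [set k]) by [].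
have pge0 k : (0 <= poisson_prob rate j [set k])%E by exact: measure_ge0.
rewrite (ge0_integral_nat_valued _ (tau := id) (f := fun k => k%:R%:E * f k)%E)//.
  rewrite (ge0_integral_nat_valued _ (tau := id) (f := fun k => f k.+1)%E)//.
  rewrite -nneseriesZl; last by move=> k _; rewrite mule_ge0.
  rewrite nneseries_recl//; last by move=> k _; rewrite !mule_ge0 ?lee_fin.
  rewrite mul0e mul0e add0e -nneseries_addn; last first.
    by move=> k; rewrite !mule_ge0 ?lee_fin.
  apply: eq_eseriesr => k _; rewrite addn1 !preimage_id.
  rewrite [LHS]muleAC [RHS]muleCA [LHS]muleC.
  rewrite /= !poisson_prob1// -!EFinM.
  suff -> : k.+1%:R * (rate ^+ k.+1 / k.+1`!%:R * expR (- rate))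
      = rate * (rate ^+ k / k`!%:R * expR (- rate)) by [].
  have kn0 : k.+1%:R != 0 :> R by rewrite pnatr_eq0.
  have fn0 : k`!%:R != 0 :> R by rewrite pnatr_eq0 -lt0n fact_gt0.
  rewrite exprS factS natrM; move: kn0 fn0.
  by move: k.+1%:R k`!%:R => a b a0 b0; field; rewrite a0 b0.
by move=> k; rewrite mule_ge0 ?lee_fin.
Qed.

Lemma poisson_mean (rate : R) j : 0 <= rate ->
  (\int[poisson_prob rate j]_k k%:R%:E = rate%:E)%E.
Proof.
move=> rate0; have := @poisson_chen_stein rate j (cst 1%E) rate0.
under eq_integral do rewrite /= mule1.
by move=> -> //; rewrite integral_cst//= [poisson_prob _ _ _]probability_setT !mule1.
Qed.

Lemma poisson_moment2 (rate : R) j : 0 <= rate ->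
  (\int[poisson_prob rate j]_k (k%:R ^+ 2)%:E = (rate ^+ 2 + rate)%:E)%E.
Proof.
move=> rate0.
have := @poisson_chen_stein rate j (fun k => k%:R%:E)%E rate0.
under eq_integral do rewrite /= -EFinM -expr2.
move=> ->; last by move=> k; rewrite lee_fin.
under eq_integral do rewrite -natr1 EFinD.
rewrite ge0_integralD//.
by rewrite poisson_mean// integral_cst//= [poisson_prob _ _ _]probability_setT mule1 -EFinD -EFinM
  mulrDr mulr1 expr2.
Qed.

Lemma poisson_affine_variance (rate c : R) j : 0 <= rate -> 0 <= c ->
  (\int[poisson_prob rate j]_k ((c * k%:R - c * rate) ^+ 2)%:E
   = (c ^+ 2 * rate)%:E)%E.
Proof.
move=> rate0 c0.
have m (f : nat -> R) : measurable_fun setT (EFin \o f) by [].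
have pZ (a : R) (f : nat -> R) : 0 <= a -> (forall k, 0 <= f k) ->
    (\int[poisson_prob rate j]_k (a * f k)%:E
     = a%:E * \int[poisson_prob rate j]_k (f k)%:E)%E.
  move=> a0 f0; under eq_integral do rewrite EFinM.
  by rewrite ge0_integralZl// => k _; rewrite lee_fin.
(* The cross term is moved to the other side, so that every integrand is
   nonnegative. *)
have : (\int[poisson_prob rate j]_k ((c * k%:R - c * rate) ^+ 2
          + 2 * c ^+ 2 * rate * k%:R)%:E
       = \int[poisson_prob rate j]_k (c ^+ 2 * k%:R ^+ 2
          + (c * rate) ^+ 2)%:E)%E.
  by apply: eq_integral => k _; congr EFin; ring.
under eq_integral do rewrite EFinD.
have cr0 : 0 <= 2 * c ^+ 2 * rate by rewrite !mulr_ge0// sqr_ge0.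
rewrite ge0_integralD//; last 2 first.
- by move=> k _; rewrite lee_fin sqr_ge0.
- by move=> k _; rewrite lee_fin mulr_ge0.
under [in RHS]eq_integral do rewrite EFinD.
rewrite ge0_integralD//; last 2 first.
- by move=> k _; rewrite lee_fin mulr_ge0// ?sqr_ge0// exprn_ge0.
- by move=> k _; rewrite lee_fin sqr_ge0.
rewrite (pZ (2 * c ^+ 2 * rate))// (pZ (c ^+ 2) (fun k => k%:R ^+ 2)) ?sqr_ge0//.
rewrite poisson_mean// poisson_moment2// integral_cst//=.
rewrite [poisson_prob _ _ _]probability_setT mule1.
rewrite -!EFinM -EFinD.
case: (integral _ _ _) => [x|//|//]; rewrite -EFinD => -[E]; congr EFin.
by rewrite -[LHS](addrK (2 * c ^+ 2 * rate * rate)) E; ring.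
Qed.

End poisson.



Section pmf_convergence.
Context {R : realType}.

Lemma Rintegral_initial_segment (Q : probability nat R) (g : nat -> R) (M : R) K :
  (forall k, `|g k| <= M) ->
  \int[Q]_(k in `I_K) g k = \sum_(j < K) g j * mass Q j.
Proof.
move=> gM; elim: K => [|K IH]; first by rewrite II0 Rintegral_set0 big_ord0.
rewrite big_ord_recr /= -IH IIS Rintegral_setU//.
- congr (_ + _).
  by rewrite (@eq_Rintegral _ _ _ Q _ (cst (g K))) ?Rintegral_cst// => k;
    rewrite inE => ->.
- exact: bounded_integrable gM.
- by apply/disj_setPS => k /= [kK kE]; move: kK; rewrite kE ltnn.
Qed.

Lemma mass_initial_segment (Q : probability nat R) K :
  fine (Q `I_K) = \sum_(j < K) mass Q j.
Proof.
have := @Rintegral_initial_segment Q (cst 1) 1 K.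
rewrite Rintegral_cst// mul1r => ->; last by move=> k; rewrite normr1.
by apply: eq_bigr => j _; rewrite mul1r.
Qed.

(** The right-hand side controls the tail of Q by a finite sum of weights, which
    is what makes it stable under pointwise convergence of the weights. *)
Lemma pmf_bounded_integral (Q : probability nat R) (g : nat -> R) (M : R) K :
  (forall k, `|g k| <= M) ->
  `|\int[Q]_k g k - \sum_(j < K) g j * mass Q j| <=
    M * (1 - \sum_(j < K) mass Q j).
Proof.
move=> gM; have int_g D : Q.-integrable D (EFin \o g) by exact: bounded_integrable gM.
rewrite -(setUv `I_K) Rintegral_setU//; last first.
  by apply/disj_setPS => k /= [].
rewrite (Rintegral_initial_segment _ _ gM) addrAC subrr add0r.
apply: (le_trans (le_normr_Rintegral _ (int_g _))) => //.
apply: (@le_trans _ _ (\int[Q]_(k in ~` `I_K) cst M k)).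
  apply: le_Rintegral => //.
  - by apply: (@bounded_integrable _ _ _ _ _ M) => // k; rewrite normr_id.
  - by apply: (@bounded_integrable _ _ _ _ _ `|M|).
have QC : fine (Q (~` `I_K)) = 1 - \sum_(j < K) mass Q j.
  by rewrite probability_setC// fineB ?fin_num_measure// mass_initial_segment.
by rewrite Rintegral_cst// -QC.
Qed.

Lemma pmf_tail_cvg0 (Q : probability nat R) :
  (1 - \sum_(j < K) mass Q j) @[K --> \oo] --> (0 : R).
Proof.
rewrite -[X in _ --> X](subrr (1 : R)); apply: cvgB; first exact: cvg_cst.
have : (Q \o (fun K => `I_K)) x @[x --> \oo] --> Q (\bigcup_K `I_K).
  apply: nondecreasing_cvg_mu => // j k jk; apply/subsetPset => i /=.
  by move=> ij; exact: leq_trans jk.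
rewrite (_ : \bigcup_K _ = setT) ?probability_setT; last first.
  by apply/seteqP; split=> // i _; exists i.+1 => /=.
move=> /fine_cvgP[_]; apply: cvg_trans; apply: near_eq_cvg.
by apply: nearW => K /=; rewrite mass_initial_segment.
Qed.

(** No mass can escape to infinity, because the limit is a probability: the tail
    beyond K is 1 minus a finite sum of weights, so that it converges to the
    tail of the limit, which is small for K large. *)
Lemma pmf_cvg_bounded_integral (Q_ : nat -> probability nat R)
    (Q : probability nat R) (g : nat -> R) (M : R) :
  (forall k, mass (Q_ n) k @[n --> \oo] --> mass Q k) ->
  (forall k, `|g k| <= M) ->
  \int[Q_ n]_k g k @[n --> \oo] --> \int[Q]_k g k.
Proof.
move=> QQ gM; have M0 : 0 <= M by exact: le_trans (gM 0%N).
have sum_cvg (c : nat -> R) K : \sum_(j < K) c j * mass (Q_ n) j @[n --> \oo]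
    --> \sum_(j < K) c j * mass Q j.
  by apply: cvg_big => [|j _]; [exact: add_continuous|apply: cvgMl_tmp; exact: QQ].
have tail_cvg K : M * (1 - \sum_(j < K) mass (Q_ n) j) @[n --> \oo]
    --> M * (1 - \sum_(j < K) mass Q j).
  apply: cvgMl_tmp; apply: cvgB; first exact: cvg_cst.
  have := sum_cvg (cst 1) K; rewrite /cst.
  by under eq_bigr do rewrite mul1r; under eq_cvg do under eq_bigr do
    rewrite mul1r.
apply/cvgrPdist_le => /= e e0.
have e3 : 0 < e / 3 by rewrite divr_gt0.
have /cvgrPdist_le/(_ _ e3)[K _ /(_ K (leqnn K))/=] :
    M * (1 - \sum_(j < K) mass Q j) @[K --> \oo] --> M * 0.
  by apply: cvgMl_tmp; exact: pmf_tail_cvg0.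
rewrite mulr0 sub0r normrN => /(le_trans (ler_norm _)) tailK.
have e4 : 0 < e / 12 by rewrite divr_gt0.
near=> n.
have B := pmf_bounded_integral Q K gM.
have Bn := pmf_bounded_integral (Q_ n) K gM.
have D : `|\sum_(j < K) g j * mass Q j - \sum_(j < K) g j * mass (Q_ n) j|
   <= e / 12.
  by near: n; move/cvgrPdist_le : (sum_cvg g K); apply.
have T : `|M * (1 - \sum_(j < K) mass Q j)
           - M * (1 - \sum_(j < K) mass (Q_ n) j)| <= e / 12.
  by near: n; move/cvgrPdist_le : (tail_cvg K); apply.
move: B Bn D T; rewrite !ler_norml => /andP[? ?] /andP[? ?] /andP[? ?] /andP[? ?].
lra.
Unshelve. all: by end_near. Qed.

End pmf_convergence.

(** * Finitely determined events and conditioning on an independent environment *)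

(** Events about finitely many coordinates are described by functions on all
    families, which avoids casts between products of varying size. *)
Definition depends_on (I : eqType) S T (J : seq I) (f : (I -> S) -> T) :=
  forall x y, {in J, x =1 y} -> f x = f y.

Section cylinder.
Context d (Omega : measurableType d) d' (S : measurableType d') (I : eqType).
Variables (X : I -> Omega -> S) (u : nat -> S).
Hypothesis u_surj : forall s, exists k, u k = s.
Hypothesis measurable_point : forall s : S, measurable [set s].

(** As the values are enumerated by u, one splits according to the value of one
    coordinate and removes it from J. *)
Lemma cylinder_sigma_of (J : seq I) (f : (I -> S) -> bool) :
  depends_on J f -> sigma_of X [set w | f (X ^~ w)].
Proof.
set C := \bigcup_i preimage_set_system setT (X i) measurable.
have sigma0 : <<s C >> set0 := @measurable0 _ (g_sigma_algebraType C).
have sigmaT : <<s C >> setT := @measurableT _ (g_sigma_algebraType C).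
have sigmaI A B : <<s C >> A -> <<s C >> B -> <<s C >> (A `&` B) :=
  @measurableI _ (g_sigma_algebraType C) A B.
have sigmaU (F : nat -> set Omega) : (forall k, <<s C >> (F k)) ->
    <<s C >> (\bigcup_k F k).
  by move=> mF; exact: (@bigcupT_measurable _ (g_sigma_algebraType C)).
rewrite /sigma_of -/C; elim: J f => [f f0|i J IH g gJ].
  rewrite (_ : [set w | _] = [set w | f (fun=> u 0%N)]).
    by case: (f _); rewrite ?set_true ?set_false.
  by apply/funext => w /=; rewrite (f0 _ (fun=> u 0%N)).
pose g_ s x := g (fun i' => if i' == i then s else x i').
have -> : [set w | g (X ^~ w)]
    = \bigcup_k (X i @^-1` [set u k] `&` [set w | g_ (u k) (X ^~ w)]).
  have gE w : g_ (X i w) (X ^~ w) = g (X ^~ w).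
    by rewrite /g_; congr g; apply/funext => i'; case: eqP => [->|].
  apply/seteqP; split=> [w /= gw|w [k _ [/= <-]]]; last by rewrite gE.
  by have [k uk] := u_surj (X i w); exists k => //=; rewrite uk gE.
apply: sigmaU => k; apply: sigmaI.
  apply: sub_sigma_algebra; exists i => //.
  by exists [set u k] => //; rewrite setTI.
apply: IH => x y xy; apply: gJ => i'; rewrite inE.
by case: eqP => //= _; exact: xy.
Qed.

End cylinder.

Lemma sigma_of_measurable d (Omega : measurableType d) d' (S : measurableType d')
    (I : Type) (X : I -> {mfun Omega >-> S}) A : sigma_of X A -> measurable A.
Proof.
apply: smallest_sub; first exact: sigma_algebra_measurable.
by move=> _ [i _ [B mB <-]]; exact: measurable_funP.
Qed.

Section freezing.
Context d (Omega : measurableType d) (R : realType) (P : probability Omega R).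
Context d' (S : measurableType d') (I : eqType).
Variables (X : I -> {mfun Omega >-> S}) (u : nat -> S).
Hypothesis u_surj : forall s, exists k, u k = s.
Hypothesis measurable_point : forall s : S, measurable [set s].

Lemma measurable_depends_on d2 (T2 : measurableType d2) (J : seq I)
    (f : (I -> S) -> T2) :
  depends_on J f -> measurable_fun setT (fun w => f (X ^~ w)).
Proof.
move=> fJ _ B mB; rewrite setTI.
apply: (@sigma_of_measurable _ _ _ _ _ X).
rewrite (_ : _ @^-1` B = [set w | `[< B (f (X ^~ w)) >]]); last first.
  by apply/seteqP; split=> w /= /asboolP.
apply: (cylinder_sigma_of u_surj measurable_point (J := J)
  (f := fun x => `[< B (f x) >])).
by move=> x y /fJ ->.
Qed.

Variables (E : nat -> {mfun Omega >-> nat}).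
Variables (Q : (I -> S) -> (nat -> nat) -> bool) (n : nat).
Hypothesis Q_finite : forall e, exists J, depends_on J (Q ^~ e).
Hypothesis Q_past : forall x, depends_on (iota 0 n) (Q x).

Let code w := choice.pickle (map (E ^~ w) (iota 0 n)).
Let env c := nth 0%N (odflt [::] (choice.unpickle c : option (seq nat))).

Let QE x w : Q x (E ^~ w) = Q x (env (code w)).
Proof.
apply: Q_past => i; rewrite mem_iota add0n => /= ni.
by rewrite /env /code choice.pickleK /= (nth_map 0%N) ?size_iota// nth_iota.
Qed.

Let sigE c : sigma_of E (code @^-1` [set c]).
Proof.
rewrite (_ : _ @^-1` _ = [set w | code w == c]); last first.
  by apply/seteqP; split=> w /= /eqP.
apply: (@cylinder_sigma_of _ _ _ _ _ _ id _ _ (iota 0 n)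
  (fun e => choice.pickle (map e (iota 0 n)) == c)) => //.
  by move=> s; exists s.
by move=> x y xy; congr (_ == _); congr choice.pickle; exact/eq_in_map.
Qed.

Let sigX c : sigma_of X [set w | Q (X ^~ w) (env c)].
Proof.
have [J QcJ] := Q_finite (env c).
exact: (cylinder_sigma_of u_surj measurable_point QcJ).
Qed.

Let mE c : measurable (code @^-1` [set c]) := sigma_of_measurable (sigE c).
Let mX c : measurable [set w | Q (X ^~ w) (env c)] := sigma_of_measurable (sigX c).

Let QcupE : [set w | Q (X ^~ w) (E ^~ w)] =
  \bigcup_c ([set w | Q (X ^~ w) (env c)] `&` code @^-1` [set c]).
Proof.
apply/seteqP; split=> [w /=|w [c _ [/= Qw wc]]]; rewrite QE ?wc// => Qw.
by exists (code w).
Qed.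

Lemma measurable_two_sources : measurable [set w | Q (X ^~ w) (E ^~ w)].
Proof. by rewrite QcupE; apply: bigcup_measurable => c _; exact: measurableI. Qed.

(** Fubini for an independent environment. The first n values of E are coded by
    one integer; on each fibre of the code the event involves X only, and
    independence applies. *)
Lemma freezing : independent_systems P (sigma_of X) (sigma_of E) ->
  P [set w | Q (X ^~ w) (E ^~ w)]
  = (\int[P]_w P [set w' | Q (X ^~ w') (E ^~ w)])%E.
Proof.
move=> indep; under [RHS]eq_integral => w _.
  rewrite (_ : [set w' | _] = [set w' | Q (X ^~ w') (env (code w))]); last first.
    by apply/funext => w' /=; rewrite QE.
  over.
rewrite (ge0_integral_nat_valued P (tau := code)
  (f := fun c => P [set w' | Q (X ^~ w') (env c)]))//.
rewrite QcupE measure_semi_bigcup//.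
- by apply: eq_eseriesr => c _; exact: indep.
- by move=> c; exact: measurableI.
- by move=> a b _ _ [w [[_ /= <-] [_ /= <-]]].
- by apply: bigcup_measurable => c _; exact: measurableI.
Qed.

End freezing.

Lemma bool_enumerable (b : bool) : exists k, odd k = b.
Proof. by case: b; [exists 1%N|exists 0%N]. Qed.

Lemma measurable_trial_event d (Omega : measurableType d) (I : eqType)
    (X : I -> {mfun Omega >-> bool}) (J : seq I) (f : (I -> bool) -> bool) :
  depends_on J f -> measurable [set w | f (X ^~ w)].
Proof.
move=> fJ; apply: (@sigma_of_measurable _ _ _ _ _ X).
exact: (cylinder_sigma_of (u := odd) bool_enumerable) fJ.
Qed.

Lemma measurable_environment d (Omega : measurableType d)
    (E : nat -> {mfun Omega >-> nat}) d' (T : measurableType d') n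
    (f : (nat -> nat) -> T) :
  depends_on (iota 0 n) f -> measurable_fun setT (fun w => f (E ^~ w)).
Proof.
by apply: (@measurable_depends_on _ _ _ _ _ E id) => // s; exists s.
Qed.

(** * The branching mechanism in a fixed environment *)

Section environment.
Local Open Scope nat_scope.
Implicit Types (z : nat * nat -> bool) (e : nat -> nat) (J : seq (nat * nat)).

Fixpoint population z e t : nat :=
  if t is s.+1 then \sum_(j < population z e s) z (s, j : nat) + e s else 0.

Definition immigrants e t := \sum_(s < t) e s.

(** The slots of survival marks that a population without deaths would use
    before time n. They depend on the immigration alone, unlike the marks that
    the process really reads, and this is what makes the count of failures
    binomial. *)
Definition cells e n : seq (nat * nat) :=
  [seq (t, j) | t <- iota 0 n, j <- iota 0 (immigrants e t)].

Definition idle_cells e n := [seq x <- cells e n | e x.1 == 0].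

Definition deaths z J := count (fun x => ~~ z x) J.

Definition drops z e n := \sum_(t < n) (population z e t.+1 < population z e t).

Definition twin_deaths z e n :=
  [exists t : 'I_n, [exists i : 'I_(immigrants e t), [exists j : 'I_(immigrants e t),
     [&& i < j, ~~ z (t : nat, i : nat) & ~~ z (t : nat, j : nat)]]]].

(** When at most K marks fail in all, the population falls short of its upper
    bound by at most K, so that the failed marks that the process does not read
    are among the last K of their time. The second conjunct discards the indices
    at which the subtraction is truncated. *)
Definition marginal_deaths K z e n :=
  [exists t : 'I_n, [exists j : 'I_K,
     ~~ z (t : nat, immigrants e t - j.+1) && (j < immigrants e t)]].

Lemma immigrantsS e t : immigrants e t.+1 = immigrants e t + e t.
Proof. by rewrite /immigrants big_ord_recr. Qed.

Lemma leq_immigrants e : {homo immigrants e : s t / s <= t}.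
Proof.
apply: homo_leq => // [|s]; first exact: leq_trans.
by rewrite immigrantsS leq_addr.
Qed.

Lemma uniq_cells e n : uniq (cells e n).
Proof.
apply: allpairs_uniq_dep => [|t _|[t j] [t' j'] _ _ /= [-> ->]//];
  exact: iota_uniq.
Qed.

Lemma uniq_idle_cells e n : uniq (idle_cells e n).
Proof. exact/filter_uniq/uniq_cells. Qed.

Lemma deathsE z t m : deaths z [seq (t, j) | j <- iota 0 m] =
  \sum_(j < m) ~~ z (t, j : nat).
Proof.
rewrite /deaths count_map -sum1_count -(big_mkord xpredT (fun j => ~~ z (t, j) : nat)).
by rewrite /index_iota subn0 big_mkcond.
Qed.

Lemma cellsS e n : cells e n.+1 =
  cells e n ++ [seq (n, j) | j <- iota 0 (immigrants e n)].
Proof.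
by rewrite /cells -addn1 iotaD map_cat flatten_cat /= cats0.
Qed.

Lemma idle_cellsS e n : idle_cells e n.+1 = idle_cells e n ++
  (if e n == 0 then [seq (n, j) | j <- iota 0 (immigrants e n)] else [::]).
Proof.
rewrite /idle_cells cellsS filter_cat filter_map; congr (_ ++ _).
by case: ifP => en0; rewrite /preim /= en0 ?filter_predT ?filter_pred0.
Qed.

Lemma size_cells e n : size (cells e n) = \sum_(t < n) immigrants e t.
Proof.
elim: n => [|n IH]; first by rewrite big_ord0.
by rewrite cellsS size_cat IH size_map size_iota big_ord_recr.
Qed.

Lemma size_idle_cells e n :
  size (idle_cells e n) = \sum_(t < n) (e t == 0) * immigrants e t.
Proof.
elim: n => [|n IH]; first by rewrite big_ord0.
rewrite idle_cellsS size_cat IH big_ord_recr /=; congr (_ + _).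
by case: eqP => _; rewrite ?size_map ?size_iota ?mul1n ?mul0n.
Qed.

Lemma deaths_cellsS z e n : deaths z (cells e n.+1) =
  deaths z (cells e n) + \sum_(j < immigrants e n) ~~ z (n, j : nat).
Proof. by rewrite cellsS /deaths count_cat -/(deaths _ _) -deathsE. Qed.

Lemma deaths_idle_cellsS z e n : deaths z (idle_cells e n.+1) =
  deaths z (idle_cells e n) +
  (e n == 0) * \sum_(j < immigrants e n) ~~ z (n, j : nat).
Proof.
rewrite idle_cellsS /deaths count_cat -/(deaths _ _) -deathsE.
by case: eqP => _; rewrite ?mul1n ?mul0n.
Qed.

Lemma sum_survivors z t m :
  \sum_(j < m) z (t, j : nat) + \sum_(j < m) ~~ z (t, j : nat) = m.
Proof.
rewrite -big_split /= -[RHS]muln1 -[in RHS](card_ord m) -sum_nat_const.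
by apply: eq_bigr => j _; case: (z _).
Qed.

Lemma leq_sum_ord (f : nat -> nat) m n : m <= n ->
  \sum_(j < m) f j <= \sum_(j < n) f j.
Proof.
move=> mn; rewrite -!(big_mkord xpredT).
by rewrite (big_cat_nat (leq0n m) mn) leq_addr.
Qed.

(** Without deaths the population would consist of all past immigrants; every
    individual lost corresponds to a failed mark in a cell. *)
Lemma population_bounds z e t :
  population z e t <= immigrants e t <= population z e t + deaths z (cells e t).
Proof.
elim: t => [|t /andP[IH1 IH2]]; first by rewrite /immigrants big_ord0.
rewrite immigrantsS deaths_cellsS /=.
have := sum_survivors z t (population z e t).
have /= := leq_sum_ord (fun j => ~~ z (t, j)) IH1.
lia.
Qed.

Lemma leq_deaths_cells z e : {homo (fun n => deaths z (cells e n)) : s t / s <= t}.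
Proof.
apply: homo_leq => // [|s]; first exact: leq_trans.
by rewrite deaths_cellsS leq_addr.
Qed.

(** At each time the process reads all failed marks of that time, because none of
    the last K fails, and there is at most one. The population then decreases
    exactly when this mark has failed and no immigrant makes up for it. *)
Lemma drops_deaths K z e n : ~~ twin_deaths z e n ->
  deaths z (cells e n) <= K -> ~~ marginal_deaths K z e n ->
  drops z e n = deaths z (idle_cells e n).
Proof.
move=> twin few marg; rewrite /drops.
have main t : t < n -> nat_of_bool (population z e t.+1 < population z e t) =
    (e t == 0) * \sum_(j < immigrants e t) ~~ z (t, j : nat).
  move=> tn; have /andP[XS SX] := population_bounds z e t.
  have SXK : immigrants e t <= population z e t + K.
    apply: leq_trans SX _; rewrite leq_add2l; apply: leq_trans few.
    exact/leq_deaths_cells/ltnW.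
  set B := (X in _ * X).
  have BE : B = \sum_(j < population z e t) ~~ z (t, j : nat).
    rewrite /B -!(big_mkord xpredT (fun j => nat_of_bool (~~ z (t, j)))).
    rewrite (big_cat_nat (n := population z e t))//= [X in _ + X]big_nat_cond.
    rewrite [X in _ + X]big1 ?addn0// => j /andP[/andP[Xj jS] _].
    apply/eqP; rewrite eqb0 negbK; apply: contraNT marg => zj.
    apply/existsP; exists (Ordinal tn); apply/existsP => /=.
    have jK : immigrants e t - j.+1 < K by lia.
    exists (Ordinal jK) => /=.
    have -> : immigrants e t - (immigrants e t - j.+1).+1 = j by lia.
    by rewrite zj /=; lia.
  have B1 : B <= 1.
    rewrite leqNgt; apply: contra twin; rewrite /B => B2.
    apply/existsP; exists (Ordinal tn) => /=.
    have : 1 < #|[pred j : 'I_(immigrants e t) | ~~ z (t, j : nat)]|.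
      by rewrite -sum1_card big_mkcond.
    move=> /card_gt1P[i [j [zi zj ij]]].
    wlog: i j zi zj ij / i < j => [H|ltij].
      case: (ltngtP i j) => ij'; first exact: (H i j).
        by apply: (H j i) => //; rewrite eq_sym.
      by move: ij; rewrite -val_eqE /= ij' eqxx.
    apply/existsP; exists i; apply/existsP; exists j.
    by move: zi zj; rewrite !inE ltij => -> ->.
  have /= := sum_survivors z t (population z e t); rewrite -BE.
  move=> surv; case: eqP => [->|e0]; rewrite ?addn0 ?mul1n ?mul0n; lia.
elim: n main {twin few marg} => [|n IH] main; first by rewrite big_ord0.
rewrite big_ord_recr /= deaths_idle_cellsS IH ?main// => t tn.
by apply: main; exact: leqW.
Qed.

Definition exceptional K z e n :=
  [|| twin_deaths z e n, K < deaths z (cells e n) | marginal_deaths K z e n].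

Lemma leq_size_cells e n : size (cells e n) <= n * immigrants e n.
Proof.
rewrite size_cells -[X in X * _](card_ord n) -sum_nat_const.
by apply: leq_sum => t _; exact/leq_immigrants/ltnW.
Qed.

Lemma mem_cells e n t j :
  ((t, j) \in cells e n) = (t < n) && (j < immigrants e t).
Proof.
apply/allpairsPdep/andP => [[t' [j' []]]|[tn jt]].
  by rewrite !mem_iota !add0n => /= t'n j't' [-> ->].
by exists t, j; rewrite !mem_iota.
Qed.

Lemma depends_on_deaths (J J' : seq (nat * nat)) : {subset J' <= J} ->
  depends_on J (fun z => deaths z J').
Proof.
by move=> J'J z z' zz'; apply: eq_in_count => x /J'J xJ; rewrite zz'.
Qed.

Lemma depends_on_twin_deaths e n :
  depends_on (cells e n) (fun z => twin_deaths z e n).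
Proof.
move=> z z' zz'.
apply: eq_existsb => t; apply: eq_existsb => i; apply: eq_existsb => j.
by rewrite !zz'// mem_cells !ltn_ord.
Qed.

Lemma depends_on_marginal_deaths K e n :
  depends_on (cells e n) (fun z => marginal_deaths K z e n).
Proof.
move=> z z' zz'; apply: eq_existsb => t; apply: eq_existsb => j.
have [jt|_] := ltnP j (immigrants e t); last by rewrite !andbF.
by rewrite zz'// mem_cells ltn_ord ltn_subrL (leq_ltn_trans _ jt).
Qed.

Lemma depends_on_exceptional K e n :
  depends_on (cells e n) (fun z => exceptional K z e n).
Proof.
move=> z z' zz'; rewrite /exceptional (depends_on_twin_deaths zz').
by rewrite (depends_on_marginal_deaths _ zz') (depends_on_deaths (fun x xJ => xJ) zz').
Qed.

Lemma depends_on_immigrants n t : t <= n ->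
  depends_on (iota 0 n) (fun e => immigrants e t).
Proof.
move=> tn e e' ee'; apply: eq_bigr => s _; apply: ee'.
by rewrite mem_iota /= add0n (leq_trans (ltn_ord s)).
Qed.

Lemma depends_on_cells n : depends_on (iota 0 n) (cells ^~ n).
Proof.
move=> e e' ee'; congr flatten; apply/eq_in_map => t; rewrite mem_iota => /= tn.
by rewrite (depends_on_immigrants _ ee')// ltnW.
Qed.

Lemma depends_on_idle_cells n : depends_on (iota 0 n) (idle_cells ^~ n).
Proof.
move=> e e' ee'; rewrite /idle_cells (depends_on_cells ee').
apply/eq_in_filter => -[t j]; rewrite mem_cells => /andP[tn _] /=.
by rewrite ee'// mem_iota.
Qed.

Lemma depends_on_exceptional_env K z n :
  depends_on (iota 0 n) (fun e => exceptional K z e n).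
Proof.
move=> e e' ee'; congr [|| _, _ | _].
- apply: eq_existsb => t.
  by rewrite (depends_on_immigrants _ ee')// ltnW.
- by rewrite (depends_on_cells ee').
- apply: eq_existsb => t; apply: eq_existsb => j.
  by rewrite (depends_on_immigrants _ ee')// ltnW.
Qed.

End environment.

(** * Counting failures in Bernoulli trials *)

(** Pascal's rule: condition on the outcome of one more trial. *)
Lemma binomial_pmfS (R : realType) n (q : R) k :
  binomial_pmf n q k * q + binomial_pmf n q k.+1 * (1 - q)
  = binomial_pmf n.+1 q k.+1.
Proof.
rewrite /binomial_pmf binS mulrnDr addrC !mulrnAl subSS; congr (_ + _).
  have [kn|nk] := ltnP k n; last by rewrite bin_small// !mulr0n.
  by rewrite -mulrA -exprSr subnSK.
by rewrite mulrAC -exprSr.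
Qed.

Lemma independent_seq d (Omega : measurableType d) (R : realType)
    (P : probability Omega R) d' (S : measurableType d') (I : choiceType)
    (X : I -> {mfun Omega >-> S}) (L : seq I) (A : I -> set S) :
  mutually_independent P (fun i => X i) -> (forall i, measurable (A i)) ->
  uniq L ->
  P (\bigcap_(i in [set` L]) X i @^-1` A i)
  = (\prod_(i <- L) P (X i @^-1` A i))%E.
Proof.
move=> indep mA uL.
have -> : (\prod_(i <- L) P (X i @^-1` A i)
    = \prod_(i <- [fset i in L]%fset) P (X i @^-1` A i))%E.
  by apply: perm_big; apply: uniq_perm => // i; rewrite !inE.
rewrite -indep// (_ : [set` L] = [set` [fset i in L]%fset])//.
by apply/seteqP; split=> i /=; rewrite !inE.
Qed.

Section bernoulli_trials.
Context d (Omega : measurableType d) (R : realType) (P : probability Omega R).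
Context (I : choiceType) (X : I -> {mfun Omega >-> bool}) (q : R).
Hypothesis failure : forall i, P (X i @^-1` [set false]) = q%:E.
Hypothesis indep : mutually_independent P (fun i => X i).

Lemma success i : P (X i @^-1` [set true]) = (1 - q)%:E.
Proof.
rewrite (_ : _ @^-1` _ = ~` (X i @^-1` [set false])).
  by rewrite probability_setC ?failure// -[X in measurable X]setTI;
    exact: measurable_funP.
by apply/seteqP; split=> w /=; case: (X i w).
Qed.

(** The event on the trials of L lets the induction on J go through: the trial
    removed from J joins L with its outcome prescribed. *)
Lemma probability_count_failures_cond (J L : seq I) (A : I -> set bool) k :
  uniq (J ++ L) ->
  P ([set w | count (fun i => ~~ X i w) J == k]
      `&` \bigcap_(i in [set` L]) X i @^-1` A i)
  = ((binomial_pmf (size J) q k)%:E * \prod_(i <- L) P (X i @^-1` A i))%E.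
Proof.
elim: J L A k => [|i J IH] L A k.
  move=> /= uL; rewrite /binomial_pmf -independent_seq//; case: k => [|k] /=.
    rewrite expr0 subnn expr0 mulr1 bin0 mulr1n mul1e; congr (P _).
    by rewrite (_ : [set w | _] = setT) ?setTI//; apply/seteqP; split.
  rewrite bin0n mulr0n mul0e (_ : [set w | _] = set0) ?set0I ?measure0//.
  by apply/seteqP; split.
rewrite cat_cons cons_uniq mem_cat negb_or -andbA => /and3P[iJ iL uJL].
pose Ab b j := if j == i then [set b] else A j.
have uJiL : uniq (J ++ i :: L).
  by rewrite -cat_rcons -cats1 -catA (perm_uniq (permEl (perm_catCA _ _ _)))
    cons_uniq mem_cat negb_or iJ iL.
have capE b : \bigcap_(j in [set` i :: L]) X j @^-1` Ab b j
    = X i @^-1` [set b] `&` \bigcap_(j in [set` L]) X j @^-1` A j.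
  apply/seteqP; split=> [w Abw|w [Xi Aw] j /=].
    split; first by have := Abw i; rewrite /Ab eqxx; apply; exact: mem_head.
    move=> j jL; have := Abw j; rewrite /Ab ifF; last first.
      by apply/negbTE; apply: contraNneq iL => <-.
    by apply; rewrite /= inE jL orbT.
  by rewrite inE /Ab; case: eqVneq => [->//|_ /=]; exact: Aw.
have prodE b : (\prod_(j <- i :: L) P (X j @^-1` Ab b j)
    = P (X i @^-1` [set b]) * \prod_(j <- L) P (X j @^-1` A j))%E.
  rewrite big_cons /Ab eqxx; congr (_ * _)%E; apply: eq_big_seq => j jL.
  by rewrite ifF//; apply/negbTE; apply: contraNneq iL => <-.
have splitE : [set w | count (fun i0 => ~~ X i0 w) (i :: J) == k]
      `&` \bigcap_(j in [set` L]) X j @^-1` A j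
    = (if k is k'.+1 then [set w | count (fun i0 => ~~ X i0 w) J == k']
        `&` \bigcap_(j in [set` i :: L]) X j @^-1` Ab false j else set0)
      `|` ([set w | count (fun i0 => ~~ X i0 w) J == k]
        `&` \bigcap_(j in [set` i :: L]) X j @^-1` Ab true j).
  rewrite !capE; apply/seteqP; split=> w /=.
    case Xi: (X i w) => /= -[]; rewrite ?add0n ?add1n => Jk Aw; first by right.
    by left; case: k Jk => // k; rewrite eqSS => Jk; split.
  case: k => [|k] [].
  - by [].
  - by move=> [Jk [-> Aw]]; rewrite add0n.
  - by move=> [Jk [-> Aw]]; rewrite add1n eqSS.
  - by move=> [Jk [-> Aw]]; rewrite add0n.
have mJ k' : measurable [set w | count (fun i0 => ~~ X i0 w) J == k'].
  apply: (measurable_trial_event X (J := J)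
    (f := fun x => count (fun i0 => ~~ x i0) J == k')) => x y xy.
  by congr (_ == _); apply: eq_in_count => j /xy ->.
have mL B : measurable (\bigcap_(j in [set` (i :: L)]) X j @^-1` B j).
  apply: fin_bigcap_measurable => // j _; rewrite -[X in measurable X]setTI.
  exact: measurable_funP.
have PU A1 A2 : measurable A1 -> measurable A2 -> A1 `&` A2 = set0 ->
    P (A1 `|` A2) = (P A1 + P A2)%E by exact: measureU.
have mL0 : measurable (\bigcap_(j in [set` L]) X j @^-1` A j).
  apply: fin_bigcap_measurable => // j _; rewrite -[X in measurable X]setTI.
  exact: measurable_funP.
rewrite splitE PU//; first last.
- rewrite !capE; case: k {splitE} => [|k]; first by rewrite set0I.
  by apply/seteqP; split=> // w [[_ [/= -> _]] [_ [/= ]]].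
- by apply: measurableI.
- by case: k {splitE} => // k; apply: measurableI.
rewrite IH// prodE success; case: k {splitE} => [|k].
  rewrite measure0 add0e muleA -EFinM; congr (_%:E * _)%E.
  by rewrite /binomial_pmf !bin0 /= !subn0 !mulr1n !expr0 !mul1r exprSr.
rewrite IH// prodE failure !muleA -!EFinM -muleDl//; last first.
  have uL : uniq L by move: uJL; rewrite cat_uniq => /and3P[].
  by rewrite -independent_seq// fin_num_measure.
by rewrite -EFinD binomial_pmfS.
Qed.

Lemma probability_count_failures (J : seq I) k : uniq J ->
  P [set w | count (fun i => ~~ X i w) J == k] = (binomial_pmf (size J) q k)%:E.
Proof.
move=> uJ; have := @probability_count_failures_cond J [::] (fun=> setT) k.
rewrite cats0 big_nil mule1 => /(_ uJ) <-; congr (P _).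
by rewrite (_ : \bigcap_(i in _) _ = setT) ?setIT//; apply/seteqP; split.
Qed.

Lemma probability_two_failures i j : i != j ->
  P [set w | ~~ X i w && ~~ X j w] = (q ^+ 2)%:E.
Proof.
move=> ij; have uij : uniq [:: i; j] by rewrite /= inE ij.
have mfalse (l : I) : measurable [set false] by [].
have := independent_seq indep mfalse uij.
rewrite !big_cons big_nil mule1 !failure -EFinM -expr2 => <-; congr (P _).
apply/seteqP; split=> w /=.
  by move=> /andP[Xi Xj] l; rewrite /= !inE => /orP[]/eqP -> /=; apply/negbTE.
by move=> Xij; apply/andP; split; apply/negbT/Xij; rewrite /= !inE eqxx ?orbT.
Qed.

Lemma measurable_failure i : measurable [set w | ~~ X i w].
Proof.
rewrite (_ : [set w | _] = X i @^-1` [set false]).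
  by rewrite -[X in measurable X]setTI; exact: measurable_funP.
by apply/seteqP; split=> w /=; case: (X i w).
Qed.

Lemma measurable_count_failures J : measurable_fun setT
  (fun w => count (fun i => ~~ X i w) J).
Proof.
apply: (@measurable_depends_on _ _ _ _ _ X odd _ _ _ _ J
    (fun x => count (fun i0 => ~~ x i0) J)) => //.
  exact: bool_enumerable.
by move=> x y xy; apply: eq_in_count => j /xy ->.
Qed.

(** Markov's inequality, written without division so that K may be 0. *)
Lemma count_failures_markov (J : seq I) K :
  (K%:R%:E * P [set w | (K < count (fun i => ~~ X i w) J)%N]
   <= (q * (size J)%:R)%:E)%E.
Proof.
set A := [set w | _].
have mA : measurable A.
  rewrite (_ : A = (fun w => count (fun i => ~~ X i w) J) @^-1` [set k | (K < k)%N]).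
    by rewrite -[X in measurable X]setTI; apply: measurable_count_failures.
  by [].
have -> : P A = (\int[P]_w (\1_A w)%:E)%E by rewrite integral_indic// setIT.
rewrite -ge0_integralZl//=; last by apply/measurable_EFinP.
apply: (@le_trans _ _ (\int[P]_w \sum_(i <- J) (\1_[set w | ~~ X i w] w)%:E)%E).
  apply: ge0_le_integral => //.
  - by apply/measurable_EFinP; apply: measurable_funM.
  - apply: emeasurable_sum => i; apply/measurable_EFinP.
    exact/measurable_indic/measurable_failure.
  - move=> w _; rewrite sumEFin -EFinM lee_fin.
    have -> : \sum_(i <- J) (\1_[set w | ~~ X i w] w : R)
       = (count (fun i => ~~ X i w) J)%:R.
      rewrite -sum1_count natr_sum [RHS]big_mkcond; apply: eq_bigr => i _.
      rewrite indicE; case: ifPn => Xi; first by rewrite mem_set.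
      by rewrite memNset//; exact: negP.
    rewrite indicE; case: (boolP (w \in A)) => [|_]; last by rewrite mulr0.
    by rewrite inE /A /= mulr1 ler_nat => /ltnW.
rewrite ge0_integral_sum//=; last first.
  move=> i; apply/measurable_EFinP; exact/measurable_indic/measurable_failure.
rewrite (eq_bigr (fun=> q%:E)) => [|i _].
  by rewrite sumEFin big_const_seq count_predT iter_addr_0 mulr_natr.
rewrite integral_indic ?setIT//; last exact: measurable_failure.
rewrite -(failure i); congr (P _).
by apply/seteqP; split=> w /=; case: (X i w).
Qed.

End bernoulli_trials.

(** * Averaging over the immigration *)

Section random_environment.
Context d (Omega : measurableType d) (R : realType) (P : probability Omega R).
Variables (X : nat * nat -> {mfun Omega >-> bool}) (q : R).
Hypothesis failure : forall i, P (X i @^-1` [set false]) = q%:E.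
Hypothesis indep : mutually_independent P (fun i => X i).

Let q0 : 0 <= q.
Proof. by rewrite -lee_fin -(failure (0%N, 0%N)). Qed.

Lemma probability_twin_deaths e n :
  (P [set w | twin_deaths (X ^~ w) e n] <=
    (q ^+ 2 * n%:R * (immigrants e n)%:R ^+ 2)%:E)%E.
Proof.
pose Q (t i j : nat) w := [&& (i < j)%N, ~~ X (t, i) w & ~~ X (t, j) w].
have mQ t i j : measurable [set w | Q t i j w].
  apply: (measurable_trial_event X (J := [:: (t, i); (t, j)])
    (f := fun z => [&& (i < j)%N, ~~ z (t, i) & ~~ z (t, j)])) => z z' zz'.
  by rewrite !zz'// !inE eqxx ?orbT.
have PQ t i j : (P [set w | Q t i j w] <= (q ^+ 2)%:E)%E.
  have [ij|ji] := ltnP i j; last first.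
    rewrite (_ : [set w | _] = set0) ?measure0 ?lee_fin ?sqr_ge0//.
    by apply/seteqP; split=> w //=; rewrite /Q ltnNge ji.
  rewrite -(probability_two_failures failure indep (i := (t, i)) (j := (t, j))).
    by rewrite /Q ij.
  by rewrite xpair_eqE eqxx ltn_eqF.
apply: le_trans (probability_exists P _) _ => [t|].
  by do 2!(apply: measurable_exists => ?); exact: mQ.
apply: (@le_trans _ _ (\sum_(t < n) (q ^+ 2 * (immigrants e n)%:R ^+ 2)%:E)%E).
  apply: lee_sum => t _.
  apply: le_trans (probability_exists P _) _ => [i|].
    by apply: measurable_exists => ?; exact: mQ.
  apply: (@le_trans _ _ (\sum_(i < immigrants e t)
      \sum_(j < immigrants e t) (q ^+ 2)%:E)%E).
    apply: lee_sum => i _; apply: le_trans (probability_exists P _) _ => [j|].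
      exact: mQ.
    by apply: lee_sum => j _; exact: PQ.
  rewrite !sumEFin !sumr_const !card_ord lee_fin -mulrnA -[leLHS]mulr_natr.
  rewrite ler_wpM2l ?sqr_ge0// natrM -expr2 ler_sqr ?nnegrE ?ler0n// ler_nat.
  exact/leq_immigrants/ltnW.
by rewrite sumEFin sumr_const card_ord lee_fin -[leLHS]mulr_natr mulrAC.
Qed.

Lemma probability_marginal_deaths K e n :
  (P [set w | marginal_deaths K (X ^~ w) e n] <= (q * n%:R * K%:R)%:E)%E.
Proof.
pose Q (t j : nat) w :=
  ~~ X (t, immigrants e t - j.+1)%N w && (j < immigrants e t)%N.
have mQ t j : measurable [set w | Q t j w].
  apply: (measurable_trial_event X (J := [:: (t, immigrants e t - j.+1)%N])
    (f := fun z => ~~ z (t, immigrants e t - j.+1)%N && _)) => z z' zz'.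
  by rewrite !zz'// !inE eqxx.
have PQ t j : (P [set w | Q t j w] <= q%:E)%E.
  rewrite -(failure (t, immigrants e t - j.+1)%N); apply: le_measure.
  - by rewrite inE.
  - by rewrite inE -[X in measurable X]setTI; exact: measurable_funP.
  - by move=> w /= /andP[/negbTE].
apply: le_trans (probability_exists P _) _ => [t|].
  by apply: measurable_exists => ?; exact: mQ.
apply: (@le_trans _ _ (\sum_(t < n) \sum_(j < K) q%:E)%E).
  apply: lee_sum => t _.
  apply: le_trans (probability_exists P _) _ => [i|]; first exact: mQ.
  by apply: lee_sum => j _; exact: PQ.
by rewrite !sumEFin !sumr_const !card_ord lee_fin -mulrnA mulnC -mulrA -natrM
  mulr_natr.
Qed.

Lemma probability_many_deaths K e n : (0 < K)%N ->
  (P [set w | (K < deaths (X ^~ w) (cells e n))%N] <=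
    (q * n%:R * (immigrants e n)%:R / K%:R)%:E)%E.
Proof.
move=> K0; have := count_failures_markov failure (cells e n) K.
have K0' : 0 < K%:R :> R by rewrite ltr0n.
rewrite -lee_pdivlMl// => /le_trans; apply.
rewrite -EFinM lee_fin mulrC ler_pM2r ?invr_gt0// -mulrA ler_wpM2l//.
by rewrite -natrM ler_nat leq_size_cells.
Qed.

(** Union bounds, for s immigrants: pairs of cells at the same time, Markov's
    inequality for the number of failures, and the last K cells of each of the n
    times. *)
Definition exceptional_bound K n s : R :=
  q ^+ 2 * n%:R * s%:R ^+ 2 + q * n%:R * s%:R / K%:R + q * n%:R * K%:R.

Lemma probability_exceptional K e n : (0 < K)%N ->
  (P [set w | exceptional K (X ^~ w) e n] <=
    (exceptional_bound K n (immigrants e n))%:E)%E.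
Proof.
move=> K0; pose B1 := [set w | twin_deaths (X ^~ w) e n].
pose B2 := [set w | (K < deaths (X ^~ w) (cells e n))%N].
pose B3 := [set w | marginal_deaths K (X ^~ w) e n].
have mB1 : measurable B1.
  apply: (measurable_trial_event X (J := cells e n) (f := fun z => twin_deaths z e n)).
  exact: depends_on_twin_deaths.
have mB2 : measurable B2.
  apply: (measurable_trial_event X (J := cells e n)
    (f := fun z => (K < deaths z (cells e n))%N)) => z z' zz'.
  by rewrite (depends_on_deaths (fun x xJ => xJ) zz').
have mB3 : measurable B3.
  apply: (measurable_trial_event X (J := cells e n)
    (f := fun z => marginal_deaths K z e n)).
  exact: depends_on_marginal_deaths.
rewrite (_ : [set w | _] = B1 `|` (B2 `|` B3)); last first.
  apply/seteqP; split=> w /=; rewrite /exceptional.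
    by case/or3P => h; [left|right; left|right; right].
  by case=> [h|[h|h]]; apply/or3P; [constructor 1|constructor 2|constructor 3].
apply: le_trans (measureU2 _ mB1 (measurableU _ _ mB2 mB3)) _.
rewrite /exceptional_bound -addrA EFinD leeD ?probability_twin_deaths//.
apply: le_trans (measureU2 _ mB2 mB3) _.
by rewrite EFinD leeD ?probability_many_deaths ?probability_marginal_deaths.
Qed.

Variable E : nat -> {mfun Omega >-> nat}.
Hypothesis indepXE : independent_systems P (sigma_of X) (sigma_of E).

Lemma measurable_exceptional_random K n :
  measurable [set w | exceptional K (X ^~ w) (E ^~ w) n].
Proof.
apply: (@measurable_two_sources _ _ _ _ _ X odd bool_enumerable _ E
  (fun z e => exceptional K z e n) n) => // [e|z].
- by exists (cells e n); exact: depends_on_exceptional.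
- exact: depends_on_exceptional_env.
Qed.

Lemma probability_exceptional_random K n : (0 < K)%N ->
  (P [set w | exceptional K (X ^~ w) (E ^~ w) n] <=
    \int[P]_w (exceptional_bound K n (immigrants (E ^~ w) n))%:E)%E.
Proof.
move=> K0; rewrite (@freezing _ _ _ P _ _ _ X odd bool_enumerable _ E
  (fun z e => exceptional K z e n) n)// => [|e|z].
- apply: ge0_le_integral => //.
  + pose f e := P [set w' | exceptional K (X ^~ w') e n].
    apply: (measurable_environment E (n := n) (f := f)) => e e' ee'.
    congr (P _); apply/funext => w /=.
    by rewrite (depends_on_exceptional_env _ _ ee').
  + apply: (measurable_environment E (n := n)
      (f := fun e => (exceptional_bound K n (immigrants e n))%:E)) => e e' ee'.
    by rewrite (depends_on_immigrants _ ee').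
  + by move=> w _; exact: probability_exceptional.
- by exists (cells e n); exact: depends_on_exceptional.
- exact: depends_on_exceptional_env.
Qed.

Let idle_finite k n e : exists J,
  depends_on J (fun z => deaths z (idle_cells e n) == k).
Proof.
exists (idle_cells e n) => z z' zz'.
by rewrite (depends_on_deaths (fun x xJ => xJ) zz').
Qed.

Let idle_past k n z : depends_on (iota 0 n) (fun e => deaths z (idle_cells e n) == k).
Proof. by move=> e e' ee'; rewrite (depends_on_idle_cells ee'). Qed.

Lemma measurable_idle_deaths k n :
  measurable [set w | deaths (X ^~ w) (idle_cells (E ^~ w) n) == k].
Proof.
exact: (@measurable_two_sources _ _ _ _ _ X odd bool_enumerable _ E
  (fun z e => deaths z (idle_cells e n) == k) n).
Qed.

(** Given the immigration, the failures in the idle cells are counted over a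
    fixed set of independent trials. *)
Lemma probability_idle_deaths k n :
  P [set w | deaths (X ^~ w) (idle_cells (E ^~ w) n) == k] =
  (\int[P]_w (binomial_pmf (size (idle_cells (E ^~ w) n)) q k)%:E)%E.
Proof.
rewrite (@freezing _ _ _ P _ _ _ X odd bool_enumerable _ E
  (fun z e => deaths z (idle_cells e n) == k) n)//.
apply: eq_integral => w _.
by rewrite -(probability_count_failures failure indep) ?uniq_idle_cells.
Qed.

End random_environment.

(** * Law of large numbers for the immigration *)

Section immigration.
Context d (Omega : measurableType d) (R : realType) (P : probability Omega R).
Variables (E : nat -> {mfun Omega >-> nat}) (G : probability nat R).
Hypothesis law : forall t, distribution P (E t) = G.
Hypothesis indep : mutually_independent P (fun t => E t).
Implicit Types (phi psi : nat -> R).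

Lemma integral_immigration phi t : (forall k, 0 <= phi k) ->
  (\int[P]_w (phi (E t w))%:E = \int[G]_k (phi k)%:E)%E.
Proof.
by move=> phi0; rewrite -(law t) ge0_integral_distribution.
Qed.

(** The joint law of two innovations is the product of their laws, by uniqueness
    of the product measure; Tonelli concludes. *)
Lemma integral_immigration_mul phi psi s t : s != t ->
  (forall k, 0 <= phi k) -> (forall k, 0 <= psi k) ->
  (\int[P]_w (phi (E s w) * psi (E t w))%:E
   = (\int[G]_k (phi k)%:E) * \int[G]_k (psi k)%:E)%E.
Proof.
move=> st phi0 psi0.
have pair_measurable : measurable_fun setT (fun w => (E s w, E t w)).
  by apply: measurable_fun_pair.
pose ST : {mfun Omega >-> (nat * nat)%type} := HB.pack (fun w => (E s w, E t w))
  (isMeasurableFun.Build _ _ _ _ _ pair_measurable).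
have mf : measurable_fun setT (fun x : nat * nat => (phi x.1 * psi x.2)%:E).
  apply/measurable_EFinP; apply: measurable_funM.
    by apply: (@measurableT_comp _ _ _ _ _ _ phi).
  by apply: (@measurableT_comp _ _ _ _ _ _ psi).
have f0 (x : nat * nat) : (0 <= (phi x.1 * psi x.2)%:E)%E.
  by rewrite lee_fin mulr_ge0.
rewrite -[LHS](@ge0_integral_distribution _ _ _ _ _ P ST
  (fun x => (phi x.1 * psi x.2)%:E))//.
rewrite (eq_measure_integral (G \x G)%E) => [|A mA _]; last first.
  apply/esym; apply: product_measure_unique => // A1 A2 mA1 mA2.
  have st_uniq : uniq [:: s; t] by rewrite /= inE st.
  have mA12 i : measurable ((fun i => if i == s then A1 else A2) i) by [].
  have := independent_seq indep mA12 st_uniq.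
  rewrite !big_cons big_nil mule1 eqxx [t == s]eq_sym (negbTE st) => stE.
  have lawE i B : P (E i @^-1` B) = G B by rewrite -(law i).
  transitivity (P (E s @^-1` A1) * P (E t @^-1` A2))%E; last first.
    by congr (_ * _)%E; exact: lawE.
  rewrite -stE; congr (P _).
  apply/seteqP; split=> w /=.
    move=> [w1 w2] l; rewrite /= !inE => /orP[]/eqP ->; rewrite ?eqxx//.
    by rewrite eq_sym (negbTE st).
  move=> wA; split; first by have := wA s; rewrite eqxx; apply; rewrite /= inE eqxx.
  have := wA t; rewrite eq_sym (negbTE st); apply.
  by rewrite /= !inE eqxx orbT.
rewrite fubini_tonelli1//.
rewrite /fubini_F /=.
have psiG0 : (0 <= \int[G]_k (psi k)%:E)%E.
  by apply: integral_ge0 => k _; rewrite lee_fin.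
have inner a : (\int[G]_b (phi a * psi b)%:E
    = (phi a)%:E * \int[G]_k (psi k)%:E)%E.
  under eq_integral => b _ do rewrite EFinM.
  by rewrite ge0_integralZl ?lee_fin// => k _; rewrite lee_fin.
under eq_integral => a _ do rewrite inner.
by rewrite ge0_integralZr// => k _; rewrite lee_fin.
Qed.

Section weighted_sum.
Variables (phi : nat -> R) (m v : R) (c : nat -> R).
Hypotheses (phi0 : forall k, 0 <= phi k) (c0 : forall t, 0 <= c t).
Hypothesis mean_phi : (\int[G]_k (phi k)%:E = m%:E)%E.
Hypothesis moment2_phi : (\int[G]_k (phi k ^+ 2)%:E = v%:E)%E.

Let mphi t : measurable_fun setT (fun w => phi (E t w)).
Proof. by apply: (@measurableT_comp _ _ _ _ _ _ phi). Qed.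

Let T n w := \sum_(t < n) c t * phi (E t w).

Let mT n : measurable_fun setT (T n).
Proof. by apply: measurable_sum => t; apply: measurable_funM. Qed.

Let T0 n w : 0 <= T n w.
Proof. by apply: sumr_ge0 => t _; rewrite mulr_ge0. Qed.

Let m0 : 0 <= m.
Proof.
rewrite -lee_fin -mean_phi; apply: integral_ge0 => k _.
by rewrite lee_fin.
Qed.

Lemma integral_weighted_sum n :
  (\int[P]_w (T n w)%:E = (m * \sum_(t < n) c t)%:E)%E.
Proof.
rewrite /T; under eq_integral => w _ do rewrite -sumEFin.
rewrite ge0_integral_sum//; first last.
- by move=> t w _; rewrite lee_fin mulr_ge0.
- by move=> t; apply/measurable_EFinP; apply: measurable_funM.
rewrite mulr_sumr -sumEFin; apply: eq_bigr => t _.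
under eq_integral => w _ do rewrite EFinM.
rewrite ge0_integralZl ?lee_fin//; first last.
- by move=> w _; rewrite lee_fin.
- exact/measurable_EFinP.
by rewrite integral_immigration// mean_phi -EFinM mulrC.
Qed.

(** Expanding the square, the off-diagonal terms factorise by independence and
    contribute at most the square of the mean, since all weights are
    nonnegative. *)
Lemma integral_weighted_sum_sqr n :
  (\int[P]_w (T n w ^+ 2)%:E <=
    ((m * \sum_(t < n) c t) ^+ 2 + v * \sum_(t < n) c t ^+ 2)%:E)%E.
Proof.
have mphi2 s t : measurable_fun setT (fun w => phi (E s w) * phi (E t w)).
  exact: measurable_funM.
have Tsq w : (T n w ^+ 2)%:E =
    (\sum_(s < n) \sum_(t < n) (c s * c t * (phi (E s w) * phi (E t w)))%:E)%E.
  rewrite expr2 /T mulr_suml -sumEFin; apply: eq_bigr => s _.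
  rewrite mulr_sumr -sumEFin; apply: eq_bigr => t _.
  by rewrite mulrACA.
have cc0 s t : 0 <= c s * c t by rewrite mulr_ge0.
have pp0 s t w : 0 <= phi (E s w) * phi (E t w) by rewrite mulr_ge0.
under eq_integral do rewrite Tsq.
rewrite ge0_integral_sum//; first last.
- by move=> s w _; apply: sume_ge0 => t _; rewrite lee_fin mulr_ge0.
- move=> s; apply: emeasurable_sum => t.
  by apply/measurable_EFinP; apply: measurable_funM.
have inner s : (\int[P]_w \sum_(t < n) (c s * c t * (phi (E s w) * phi (E t w)))%:E
    <= (\sum_(t < n) (c s * c t * m ^+ 2 + (s == t :> nat)%:R * (c t ^+ 2 * v)))%:E)%E.
  rewrite ge0_integral_sum//; first last.
  - by move=> t w _; rewrite lee_fin mulr_ge0.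
  - by move=> t; apply/measurable_EFinP; apply: measurable_funM.
  rewrite -sumEFin; apply: lee_sum => t _.
  under eq_integral do rewrite EFinM.
  rewrite ge0_integralZl ?lee_fin//; first last.
  - by move=> w _; rewrite lee_fin.
  - exact/measurable_EFinP.
  have [->|st] := eqVneq s t; last first.
    by rewrite integral_immigration_mul// mean_phi -!EFinM lee_fin mul0r addr0 expr2.
  under eq_integral do rewrite -expr2.
  rewrite (integral_immigration (phi := fun k => phi k ^+ 2)) => [|k].
    by rewrite moment2_phi -EFinM lee_fin mul1r expr2 lerDr mulr_ge0// sqr_ge0.
  exact: sqr_ge0.
apply: (@le_trans _ _ (\sum_(s < n) (\sum_(t < n)
    (c s * c t * m ^+ 2 + (s == t :> nat)%:R * (c t ^+ 2 * v)))%:E)%E).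
  by apply: lee_sum => s _; exact: inner.
rewrite sumEFin lee_fin le_eqVlt; apply/orP; left; apply/eqP.
under eq_bigr do rewrite big_split /=.
rewrite big_split /= exprMn; congr (_ + _).
  rewrite (expr2 (\sum_(_ < n) _)) mulr_suml mulr_sumr; apply: eq_bigr => s _.
  by rewrite !mulr_sumr; apply: eq_bigr => t _; ring.
rewrite mulr_sumr; apply: eq_bigr => s _.
rewrite (bigD1 s) //= eqxx mul1r big1 ?addr0 1?mulrC// => t ts.
by rewrite [_ == _ :> nat]eq_sym -[_ == _ :> nat]/(t == s) (negbTE ts) mul0r.
Qed.

Lemma integral_weighted_sum_deviation_sqr n :
  (\int[P]_w ((T n w - m * \sum_(t < n) c t) ^+ 2)%:E <=
    (v * \sum_(t < n) c t ^+ 2)%:E)%E.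
Proof.
set M := m * _; have M0 : 0 <= M by rewrite mulr_ge0// sumr_ge0.
have mT2 : measurable_fun setT (fun w => T n w ^+ 2) by exact: measurable_funX.
have mdev : measurable_fun setT (fun w => (T n w - M) ^+ 2).
  by apply: measurable_funX; exact: measurable_funB.
(* Moving the cross term to the other side keeps every integrand
   nonnegative. *)
have : (\int[P]_w ((T n w - M) ^+ 2 + 2 * M * T n w)%:E
    = \int[P]_w (T n w ^+ 2 + M ^+ 2)%:E)%E.
  by apply: eq_integral => w _; congr EFin; ring.
under eq_integral do rewrite EFinD (EFinM (2 * M)).
have twoM0 : 0 <= 2 * M by rewrite mulr_ge0.
rewrite ge0_integralD//; first last.
- apply: emeasurable_funM; first exact: measurable_cst.
  exact/measurable_EFinP.
- by move=> w _; rewrite mule_ge0 ?lee_fin.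
- exact/measurable_EFinP.
- by move=> w _; rewrite lee_fin sqr_ge0.
rewrite ge0_integralZl ?lee_fin//; first last.
- by move=> w _; rewrite lee_fin.
- exact/measurable_EFinP.
rewrite integral_weighted_sum -EFinM -/M.
under [in RHS]eq_integral do rewrite EFinD.
rewrite ge0_integralD//; first last.
- by move=> w _; rewrite lee_fin sqr_ge0.
- exact/measurable_EFinP.
- by move=> w _; rewrite lee_fin sqr_ge0.
rewrite integral_probability_cst.
have := integral_weighted_sum_sqr n; rewrite -/M.
have : (0 <= \int[P]_w (T n w ^+ 2)%:E)%E.
  by apply: integral_ge0 => w _; rewrite lee_fin sqr_ge0.
case: (\int[P]_w (T n w ^+ 2)%:E)%E => [a|//|//] _; rewrite lee_fin => aM.
case: (\int[P]_w ((T n w - M) ^+ 2)%:E)%E => [b|//|//] /= [baM].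
by rewrite lee_fin; nra.
Qed.

(** A substitute for the Cauchy-Schwarz inequality, based on
    2 |x| <= x^2 / r + r; the best r is the square root of v times
    the sum of the c_t^2, and any r of the same order suffices. *)
Lemma integral_weighted_sum_deviation n (r : R) : 0 < r ->
  (\int[P]_w `|T n w - m * \sum_(t < n) c t|%:E <=
    ((v * (\sum_(t < n) c t ^+ 2) / r + r) / 2)%:E)%E.
Proof.
move=> r0; set M := m * _; set V := v * \sum_(t < n) _.
have mdev : measurable_fun setT (fun w => (T n w - M) ^+ 2).
  by apply: measurable_funX; exact: measurable_funB.
have two_r0 : 0 <= (2 * r)^-1 by rewrite invr_ge0 mulr_ge0// ltW.
apply: (@le_trans _ _ (\int[P]_w ((2 * r)^-1%:E * ((T n w - M) ^+ 2)%:E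
    + (r / 2)%:E))%E).
  apply: ge0_le_integral => //.
  - by apply/measurable_EFinP; apply: measurableT_comp => //; exact: measurable_funB.
  - apply: emeasurable_funD => //; apply: emeasurable_funM => //.
    exact/measurable_EFinP.
  - move=> w _; rewrite -EFinM -EFinD lee_fin; set x := T n w - M.
    (* arithmetic-geometric mean *)
    rewrite -(ler_pM2l (x := 2 * r)) ?mulr_gt0//.
    rewrite [leRHS](_ : _ = x ^+ 2 + r ^+ 2); last by field; rewrite gt_eqF.
    rewrite -(real_normK (num_real x)); set y := `|x|.
    by have := sqr_ge0 (y - r); nra.
rewrite ge0_integralD//; first last.
- by move=> w _; rewrite lee_fin divr_ge0// ltW.
- apply: emeasurable_funM => //; exact/measurable_EFinP.
- by move=> w _; rewrite mule_ge0 ?lee_fin// sqr_ge0.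
rewrite ge0_integralZl ?lee_fin//; first last.
- by move=> w _; rewrite lee_fin sqr_ge0.
- exact/measurable_EFinP.
rewrite integral_probability_cst.
rewrite [leRHS](_ : _ = ((2 * r)^-1%:E * V%:E + (r / 2)%:E)%E); last first.
  by rewrite -EFinM -EFinD; congr EFin; field; rewrite gt_eqF.
rewrite leeD2r// lee_wpmul2l ?lee_fin//.
exact: integral_weighted_sum_deviation_sqr.
Qed.

End weighted_sum.
End immigration.

Lemma integral_mass0 (R : realType) (G : probability nat R) :
  (\int[G]_k ((k == 0%N)%:R)%:E = (mass G 0%N)%:E)%E.
Proof.
rewrite /mass fineK ?fin_num_measure//.
rewrite -[X in G X]setIT -(integral_indic G measurableT)//.
apply: eq_integral => k _; rewrite indicE; congr (_%:R%:E).
by rewrite in_set1.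
Qed.

Lemma sum_ord_double (R : comPzRingType) n :
  2 * (\sum_(t < n) t%:R) = n%:R ^+ 2 - n%:R :> R.
Proof.
elim: n => [|n IH]; first by rewrite big_ord0 mulr0 expr0n subrr.
by rewrite big_ord_recr /= mulrDr IH -natr1; ring.
Qed.

Section idle_immigration.
Context d (Omega : measurableType d) (R : realType) (P : probability Omega R).
Variables (E : nat -> {mfun Omega >-> nat}) (G : probability nat R).
Hypothesis law : forall t, distribution P (E t) = G.
Hypothesis indep : mutually_independent P (fun t => E t).
Variables (m1 m2 : R).
Hypothesis mean_G : (\int[G]_k (k%:R)%:E = m1%:E)%E.
Hypothesis moment2_G : (\int[G]_k (k%:R ^+ 2)%:E = m2%:E)%E.

Lemma mean_ge0 : 0 <= m1.
Proof. by rewrite -lee_fin -mean_G; apply: integral_ge0 => k _; rewrite lee_fin. Qed.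

Lemma moment2_ge0 : 0 <= m2.
Proof.
by rewrite -lee_fin -moment2_G; apply: integral_ge0 => k _; rewrite lee_fin exprn_ge0.
Qed.

Let immigrantsE n w : (immigrants (E ^~ w) n)%:R
  = \sum_(t < n) 1 * (E t w)%:R :> R.
Proof. by rewrite /immigrants natr_sum; apply: eq_bigr => t _; rewrite mul1r. Qed.

Let sum1 n : \sum_(t < n) (1 : R) = n%:R.
Proof. by rewrite sumr_const card_ord. Qed.

Let sum1sqr n : \sum_(t < n) (1 : R) ^+ 2 = n%:R.
Proof. by rewrite expr1n. Qed.

Lemma integral_immigrants n :
  (\int[P]_w ((immigrants (E ^~ w) n)%:R)%:E = (m1 * n%:R)%:E)%E.
Proof.
under eq_integral do rewrite immigrantsE.
by rewrite (integral_weighted_sum law (c := fun=> 1) _ _ mean_G)// sum1.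
Qed.

Lemma integral_immigrants_sqr n :
  (\int[P]_w ((immigrants (E ^~ w) n)%:R ^+ 2)%:E
    <= ((m1 ^+ 2 + m2) * n%:R ^+ 2)%:E)%E.
Proof.
under eq_integral do rewrite immigrantsE.
apply: le_trans
  (integral_weighted_sum_sqr law indep (c := fun=> 1) _ _ mean_G moment2_G n) _ => //.
rewrite lee_fin /= sum1sqr sum1 exprMn mulrDl lerD2l ler_wpM2l ?moment2_ge0//.
by rewrite -natrX ler_nat -{1}(expn1 n); case: n => // n; rewrite leq_pexp2l.
Qed.

Lemma integral_immigrants_deviation (r : R) n t : 0 < r -> r ^+ 2 = n%:R ->
  (t <= n)%N ->
  (\int[P]_w `|(immigrants (E ^~ w) t)%:R - m1 * t%:R|%:E
    <= ((m2 + 1) / 2 * r)%:E)%E.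
Proof.
move=> r0 rn tn; under eq_integral do rewrite immigrantsE -sum1.
apply: le_trans (integral_weighted_sum_deviation law indep (c := fun=> 1) _ _
  mean_G moment2_G t r0) _ => //.
rewrite lee_fin /= sum1sqr [leRHS]mulrAC ler_pM2r ?invr_gt0// mulrDl mul1r lerD2r ler_pdivrMr//.
by rewrite -mulrA -expr2 rn ler_wpM2l ?moment2_ge0// ler_nat.
Qed.

Lemma integral_idle_times_deviation (r : R) n : 0 < r -> r ^+ 2 = n%:R ->
  (\int[P]_w `|\sum_(t < n) t%:R * (E t w == 0%N)%:R
      - mass G 0%N * \sum_(t < n) t%:R|%:E <= (r ^+ 3)%:E)%E.
Proof.
move=> r0 rn; have r3 : 0 < r ^+ 3 by rewrite exprn_gt0.
have idem : (\int[G]_k ((k == 0%N)%:R ^+ 2)%:E = (mass G 0%N)%:E)%E.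
  rewrite -integral_mass0; apply: eq_integral => k _.
  by case: (k == _); rewrite ?expr1n ?expr0n.
apply: le_trans (integral_weighted_sum_deviation law indep
  (phi := fun k => (k == 0%N)%:R) (c := fun t => t%:R) _ _
  (integral_mass0 G) idem n r3) _ => //.
rewrite lee_fin ler_pdivrMr// mulr_natr mulr2n lerD2r ler_pdivrMr//.
have g1 : mass G 0%N <= 1.
  by rewrite -lee_fin /mass fineK ?fin_num_measure// probability_le1.
have -> : r ^+ 3 * r ^+ 3 = n%:R * n%:R ^+ 2 by rewrite -rn; ring.
apply: (@le_trans _ _ (1 * \sum_(t < n) n%:R ^+ 2)).
  apply: ler_pM => //.
  - by rewrite fine_ge0.
  - by apply: sumr_ge0 => t _; rewrite exprn_ge0.
  - by apply: ler_sum => t _; rewrite ler_sqr ?nnegrE// ler_nat ltnW.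
by rewrite mul1r sumr_const card_ord -[leLHS]mulr_natl.
Qed.

(** With a_t = 1 if e_t = 0 and a_t = 0 otherwise, the number of idle cells is
    the sum of the a_t S_t. Replacing S_t by m1 t and then a_t by g(0) costs the
    first two terms; the last one accounts for the sum of t over t < n being
    (n^2 - n) / 2 instead of n^2 / 2. *)
Lemma size_idle_cells_bound (e : nat -> nat) n :
  `|(size (idle_cells e n))%:R - mass G 0%N * m1 * n%:R ^+ 2 / 2| <=
  \sum_(t < n) `|(immigrants e t)%:R - m1 * t%:R|
  + m1 * `|\sum_(t < n) t%:R * (e t == 0%N)%:R - mass G 0%N * \sum_(t < n) t%:R|
  + m1 * n%:R / 2.
Proof.
set g := mass G 0%N; have g0 : 0 <= g by rewrite fine_ge0.
have g1 : g <= 1.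
  by rewrite -lee_fin /g /mass fineK ?fin_num_measure// probability_le1.
have -> : (size (idle_cells e n))%:R - g * m1 * n%:R ^+ 2 / 2
  = \sum_(t < n) (e t == 0%N)%:R * ((immigrants e t)%:R - m1 * t%:R)
    + m1 * (\sum_(t < n) t%:R * (e t == 0%N)%:R - g * \sum_(t < n) t%:R)
    - g * (m1 * n%:R / 2).
  have sE : \sum_(t < n) (e t == 0%N)%:R * ((immigrants e t)%:R - m1 * t%:R)
     = (size (idle_cells e n))%:R - m1 * \sum_(t < n) t%:R * (e t == 0%N)%:R.
    rewrite size_idle_cells natr_sum mulr_sumr -sumrB; apply: eq_bigr => t _.
    by rewrite natrM; ring.
  have -> : \sum_(t < n) t%:R = (n%:R ^+ 2 - n%:R) / 2 :> R.
    by rewrite -sum_ord_double mulrC mulKf.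
  by rewrite sE; field.
apply: le_trans (ler_normB _ _) _; apply: lerD; last first.
  rewrite normrM ger0_norm// ger0_norm; last by rewrite divr_ge0// mulr_ge0// mean_ge0.
  by rewrite ler_piMl// divr_ge0// mulr_ge0// mean_ge0.
apply: le_trans (ler_normD _ _) _; apply: lerD; last first.
  by rewrite normrM (ger0_norm mean_ge0).
apply: le_trans (ler_norm_sum _ _ _) _; apply: ler_sum => t _.
by rewrite normrM; case: (e t == _); rewrite ?normr1 ?mul1r// normr0 mul0r.
Qed.

(** Each S_t deviates by O(sqrt n), and there are n of them; the weighted number
    of idle times has variance O(n^3). Both contributions are O(n^(3/2)). *)
Lemma integral_size_idle_cells_deviation (r : R) n : 0 < r -> r ^+ 2 = n%:R ->
  (\int[P]_w `|(size (idle_cells (E ^~ w) n))%:R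
      - mass G 0%N * m1 * n%:R ^+ 2 / 2|%:E
    <= (((m2 + 1) / 2 + 2 * m1) * r ^+ 3)%:E)%E.
Proof.
move=> r0 rn.
have n0 : (0 < n)%N by rewrite -(ltr_nat R) -rn exprn_gt0.
have mS t : measurable_fun setT
    (fun w => `|(immigrants (E ^~ w) t)%:R - m1 * t%:R| : R).
  apply: (measurable_environment E (n := t)
    (f := fun e => `|(immigrants e t)%:R - m1 * t%:R|)) => e e' ee'.
  by rewrite (depends_on_immigrants _ ee').
have mT : measurable_fun setT (fun w =>
    `|\sum_(t < n) t%:R * (E t w == 0%N)%:R - mass G 0%N * \sum_(t < n) t%:R|).
  apply: (measurable_environment E (n := n)
    (f := fun e => `|\sum_(t < n) t%:R * (e t == 0%N)%:R
      - mass G 0%N * \sum_(t < n) t%:R|)) => e e' ee'.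
  congr (`|_ - _|); apply: eq_bigr => t _.
  by rewrite ee'// mem_iota add0n /=.
apply: (@le_trans _ _ (\int[P]_w
  ((\sum_(t < n) `|(immigrants (E ^~ w) t)%:R - m1 * t%:R|%:E)
  + (m1%:E * `|\sum_(t < n) t%:R * (E t w == 0%N)%:R
       - mass G 0%N * \sum_(t < n) t%:R|%:E + (m1 * n%:R / 2)%:E)))%E).
  apply: ge0_le_integral => //.
  - apply/measurable_EFinP.
    apply: (measurable_environment E (n := n)
      (f := fun e => `|(size (idle_cells e n))%:R
        - mass G 0%N * m1 * n%:R ^+ 2 / 2|)) => e e' ee'.
    by rewrite (depends_on_idle_cells ee').
  - apply: emeasurable_funD.
      by apply: emeasurable_sum => t; exact/measurable_EFinP.
    apply: emeasurable_funD => //; apply: emeasurable_funM => //.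
    exact/measurable_EFinP.
  - move=> w _; rewrite sumEFin -EFinM -!EFinD lee_fin addrA.
    exact: size_idle_cells_bound.
rewrite ge0_integralD//; first last.
- apply: emeasurable_funD => //; apply: emeasurable_funM => //.
  exact/measurable_EFinP.
- move=> w _; rewrite adde_ge0// ?mule_ge0 ?lee_fin ?mean_ge0//.
  by rewrite divr_ge0// mulr_ge0// mean_ge0.
- by apply: emeasurable_sum => t; exact/measurable_EFinP.
- by move=> w _; apply: sume_ge0.
rewrite ge0_integral_sum//; last by move=> t; exact/measurable_EFinP.
rewrite ge0_integralD//; first last.
- by move=> w _; rewrite lee_fin divr_ge0// mulr_ge0// mean_ge0.
- by apply: emeasurable_funM => //; exact/measurable_EFinP.
- by move=> w _; rewrite mule_ge0 ?lee_fin ?mean_ge0.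
rewrite ge0_integralZl ?lee_fin ?mean_ge0//; last exact/measurable_EFinP.
rewrite integral_probability_cst.
apply: (@le_trans _ _ (\sum_(t < n) ((m2 + 1) / 2 * r)%:E
  + (m1%:E * (r ^+ 3)%:E + (m1 * n%:R / 2)%:E))%E).
  apply: leeD.
    apply: lee_sum => t _; apply: integral_immigrants_deviation rn _ => //.
    exact: ltnW.
  apply: leeD => //; apply: lee_wpmul2l; rewrite ?lee_fin ?mean_ge0//.
  exact: integral_idle_times_deviation.
rewrite sumEFin sumr_const card_ord -EFinM -!EFinD lee_fin -[_ *+ n]mulr_natr.
have r1 : 1 <= r.
  by have : 1 <= r ^+ 2; [rewrite rn ler1n | rewrite expr_ge1// ltW].
have r23 : n%:R <= r ^+ 3 by rewrite exprS rn ler_peMl.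
rewrite -rn; have := mean_ge0; move: r23; rewrite -rn => r23 m10.
have : m1 * r ^+ 2 <= m1 * r ^+ 3 by rewrite ler_wpM2l.
have := moment2_ge0; have : 0 <= m1 * r ^+ 3 by rewrite mulr_ge0// exprn_ge0// ltW.
rewrite (_ : (m2 + 1) / 2 * r * r ^+ 2 = (m2 + 1) / 2 * r ^+ 3); last by ring.
by move=> ? _ ?; lra.
Qed.

(** With q = h / n^2 and S_n of order n, the three terms of the union bound are
    of order 1 / n, 1 / K and K / n: letting n and then K tend to infinity makes
    the exceptional event negligible. *)
Lemma integral_exceptional_bound K n (h : R) : 0 <= h -> (0 < n)%N -> (0 < K)%N ->
  (\int[P]_w (exceptional_bound (h / n%:R ^+ 2) K n (immigrants (E ^~ w) n))%:E
    <= (h ^+ 2 * (m1 ^+ 2 + m2) / n%:R + h * m1 / K%:R + h * K%:R / n%:R)%:E)%E.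
Proof.
move=> h0 n0 K0; set q := h / _.
have nn0 : n%:R != 0 :> R by rewrite pnatr_eq0 -lt0n.
have KK0 : K%:R != 0 :> R by rewrite pnatr_eq0 -lt0n.
have q0 : 0 <= q by rewrite divr_ge0// exprn_ge0.
have mS : measurable_fun setT (fun w => (immigrants (E ^~ w) n)%:R : R).
  apply: (measurable_environment E (n := n)
    (f := fun e => (immigrants e n)%:R : R)) => e e' ee'.
  by rewrite (depends_on_immigrants _ ee').
have mS2 : measurable_fun setT (fun w => (immigrants (E ^~ w) n)%:R ^+ 2 : R).
  exact: measurable_funX.
rewrite /exceptional_bound.
under eq_integral => w _.
  rewrite (mulrAC (q * n%:R)) EFinD EFinD.
  rewrite (EFinM (q ^+ 2 * n%:R)) (EFinM (q * n%:R / K%:R)).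
  over.
have c1 : 0 <= q ^+ 2 * n%:R by rewrite mulr_ge0// sqr_ge0.
have c2 : 0 <= q * n%:R / K%:R by rewrite divr_ge0// mulr_ge0.
have c3 : 0 <= q * n%:R * K%:R by rewrite !mulr_ge0.
have p1 w : (0 <= (q ^+ 2 * n%:R)%:E * ((immigrants (E ^~ w) n)%:R ^+ 2)%:E)%E.
  by rewrite mule_ge0 ?lee_fin// sqr_ge0.
have p2 w : (0 <= (q * n%:R / K%:R)%:E * ((immigrants (E ^~ w) n)%:R)%:E)%E.
  by rewrite mule_ge0 ?lee_fin.
have mp1 : measurable_fun setT (fun w =>
   (q ^+ 2 * n%:R)%:E * ((immigrants (E ^~ w) n)%:R ^+ 2)%:E)%E.
  by apply: emeasurable_funM => //; exact/measurable_EFinP.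
have mp2 : measurable_fun setT (fun w =>
   (q * n%:R / K%:R)%:E * ((immigrants (E ^~ w) n)%:R)%:E)%E.
  by apply: emeasurable_funM => //; exact/measurable_EFinP.
rewrite ge0_integralD//; first last.
- exact: emeasurable_funD.
- by move=> w _; rewrite adde_ge0.
rewrite ge0_integralD//.
have pullZ (a : R) (f : Omega -> R) : 0 <= a -> measurable_fun setT f ->
    (forall w, 0 <= f w) ->
    (\int[P]_w (a%:E * (f w)%:E) = a%:E * \int[P]_w (f w)%:E)%E.
  move=> a0 mf f0; rewrite ge0_integralZl ?lee_fin//; first exact/measurable_EFinP.
  by move=> w _; rewrite lee_fin.
rewrite (pullZ (q ^+ 2 * n%:R))//.
rewrite (pullZ (q * n%:R / K%:R))//.
rewrite integral_probability_cst integral_immigrants.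
rewrite (_ : (h ^+ 2 * _ / _ + _ + _)%:E
   = ((q ^+ 2 * n%:R)%:E * ((m1 ^+ 2 + m2) * n%:R ^+ 2)%:E
     + (q * n%:R / K%:R)%:E * (m1 * n%:R)%:E + (q * n%:R * K%:R)%:E)%E).
  rewrite leeD2r// leeD2r// lee_wpmul2l ?lee_fin//.
  exact: integral_immigrants_sqr.
by rewrite -!EFinM -!EFinD /q; congr EFin; field; rewrite nn0 KK0.
Qed.

End idle_immigration.

(** * Poisson approximation of binomial laws *)

Section poisson_approximation.
Context {R : realType}.
Implicit Types q x y lam : R.

Lemma binomial_pmf_bounds n q k : 0 <= q <= 1 -> 0 <= binomial_pmf n q k <= 1.
Proof.
move=> q01; rewrite binomial_pmf_ge0//=.
have [nk|kn] := ltnP n k; first by rewrite /binomial_pmf bin_small// mulr0n ler01.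
have term_ge0 i : 0 <= binomial_pmf n q i by exact: binomial_pmf_ge0.
have <- : \sum_(i < n.+1) binomial_pmf n q i = 1.
  rewrite -[RHS](expr1n _ n) -[in RHS](subrK q 1) exprDn.
  apply: eq_bigr => i _; rewrite /binomial_pmf; congr (_ *+ _).
  by rewrite mulrC.
by rewrite (bigD1 (inord k)) //= inordK// lerDl sumr_ge0.
Qed.

Lemma binomial_pmf_ratio n q k :
  k.+1%:R * binomial_pmf n q k.+1 * (1 - q)
  = (n%:R - k%:R) * q * binomial_pmf n q k.
Proof.
have [kn|nk] := ltnP k n; last first.
  rewrite /binomial_pmf [in LHS]bin_small// mulr0n mulr0 mul0r.
  move: nk; rewrite leq_eqVlt => /predU1P[->|nk]; first by rewrite subrr !mul0r.
  by rewrite bin_small// mulr0n mulr0.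
rewrite /binomial_pmf -natrB 1?ltnW// -(mulr_natr _ 'C(n, k.+1)) -(mulr_natr _ 'C(n, k)).
have := mul_bin_left n k => /(congr1 (fun i => i%:R : R)); rewrite !natrM => C.
have -> : (1 - q) ^+ (n - k) = (1 - q) * (1 - q) ^+ (n - k.+1).
  by rewrite -exprS subnSK.
transitivity (q * q ^+ k * ((1 - q) * (1 - q) ^+ (n - k.+1))
    * (k.+1%:R * 'C(n, k.+1)%:R)); first by rewrite exprS; ring.
by rewrite C; ring.
Qed.

(** The exact ratio of consecutive binomial weights has n - k in place of n and a
    factor 1 - q; both defects cost a multiple of q. The bound is affine in
    |q n - lam|, so that it can be averaged over a random number of trials. *)
Lemma binomial_pmf_chen_stein n q lam k : 0 <= q <= 1 ->
  `|k.+1%:R * binomial_pmf n q k.+1 - lam * binomial_pmf n q k| <=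
  `|q * n%:R - lam| + (2 * k%:R + 1) * q.
Proof.
move=> q01; have [q0 q1] := andP q01.
have /andP[b0 b1] := binomial_pmf_bounds n k q01.
have /andP[c0 c1] := binomial_pmf_bounds n k.+1 q01.
have := binomial_pmf_ratio n q k.
move: (binomial_pmf n q k) (binomial_pmf n q k.+1) b0 b1 c0 c1 => b c b0 b1 c0 c1.
move=> ratio.
have -> : k.+1%:R * c - lam * b = k.+1%:R * q * c + (q * n%:R - lam) * b - k%:R * q * b.
  have -> : k.+1%:R * c = k.+1%:R * c * (1 - q) + k.+1%:R * q * c by ring.
  by rewrite ratio; ring.
apply: le_trans (ler_normB _ _) _.
apply: le_trans (lerD (ler_normD _ _) (lexx _)) _.
rewrite !normrM !(ger0_norm b0) (ger0_norm c0) !(ger0_norm q0) !normr_nat.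
have h1 : k.+1%:R * q * c <= k.+1%:R * q by rewrite ler_piMr// mulr_ge0.
have h2 : `|q * n%:R - lam| * b <= `|q * n%:R - lam| by rewrite ler_piMr.
have h3 : k%:R * q * b <= k%:R * q by rewrite ler_piMr// mulr_ge0.
by move: h1; rewrite -natr1 => h1; lra.
Qed.

Lemma expRN_lipschitz x y : 0 <= x -> 0 <= y ->
  `|expR (- x) - expR (- y)| <= `|x - y|.
Proof.
wlog xy : x y / x <= y => [hw x0 y0|x0 _].
  have [|/ltW yx] := leP x y; first by move=> /hw; exact.
  by rewrite distrC (distrC x); exact: hw.
rewrite distrC (distrC x) (ger0_norm (_ : 0 <= y - x)) ?subr_ge0//.
rewrite distrC ger0_norm ?subr_ge0 ?ler_expR ?lerN2//.
have -> : - y = - x + - (y - x) by ring.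
rewrite expRD -[X in X - _]mulr1 -mulrBr.
apply: (@le_trans _ _ (1 * (y - x))); last by rewrite mul1r.
apply: ler_pM.
- exact: expR_ge0.
- by rewrite subr_ge0 -expR0 ler_expR oppr_le0 subr_ge0.
- by rewrite -expR0 ler_expR oppr_le0.
- by have := expR_ge1Dx (- (y - x)); lra.
Qed.

Lemma expRN_onem q : 0 <= q -> `|(1 - q) - expR (- q)| <= q ^+ 2.
Proof.
move=> q0; rewrite distrC ger0_norm; last first.
  by rewrite subr_ge0; have := expR_ge1Dx (- q).
rewrite lerBlDr expRN.
have e1 : 1 + q <= expR q := expR_ge1Dx q.
have e0 : 0 < 1 + q by rewrite ltr_wpDr.
apply: (@le_trans _ _ (1 + q)^-1); first by rewrite lef_pV2 ?posrE// expR_gt0.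
rewrite -[leLHS]mul1r ler_pdivrMr//.
have : 0 <= q ^+ 3 by rewrite exprn_ge0.
by nra.
Qed.

Lemma ler_normBX x y n : 0 <= x <= 1 -> 0 <= y <= 1 ->
  `|x ^+ n - y ^+ n| <= n%:R * `|x - y|.
Proof.
move=> /andP[x0 x1] /andP[y0 y1]; elim: n => [|n IH].
  by rewrite subrr normr0 mul0r.
have -> : x ^+ n.+1 - y ^+ n.+1 = x * (x ^+ n - y ^+ n) + (x - y) * y ^+ n.
  by rewrite !exprS; ring.
apply: le_trans (ler_normD _ _) _; rewrite -natr1 [leRHS]mulrDl mul1r; apply: lerD.
  rewrite normrM ger0_norm//; apply: le_trans IH.
  by rewrite ler_piMl.
rewrite normrM ler_piMr// ger0_norm ?exprn_ge0//.
exact: exprn_ile1.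
Qed.

(** (1 - q)^n is compared first with exp (- q n), factor by factor, and then with
    exp (- lam). *)
Lemma binomial_pmf0_expR n q lam : 0 <= q <= 1 -> 0 <= lam ->
  `|binomial_pmf n q 0 - expR (- lam)| <= q ^+ 2 * n%:R + `|q * n%:R - lam|.
Proof.
move=> q01 lam0; have [q0 q1] := andP q01.
have -> : binomial_pmf n q 0 = (1 - q) ^+ n.
  by rewrite /binomial_pmf expr0 mul1r subn0 bin0 mulr1n.
have -> : (1 - q) ^+ n - expR (- lam) = ((1 - q) ^+ n - expR (- q) ^+ n)
    + (expR (- (q * n%:R)) - expR (- lam)).
  have -> : - (q * n%:R) = n%:R * - q by rewrite mulrN mulrC.
  by rewrite expRM_natl addrA subrK.
apply: le_trans (ler_normD _ _) _; apply: lerD; last first.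
  by apply: expRN_lipschitz => //; rewrite mulr_ge0.
apply: le_trans (ler_normBX n _ _) _.
- by rewrite subr_ge0 q1 gerBl.
- by rewrite expR_ge0 -expR0 ler_expR oppr_le0.
- by rewrite mulrC ler_wpM2r// expRN_onem.
Qed.

End poisson_approximation.

(** * Quantitative estimates for one experiment *)

Definition idle_deaths_pmf d (Omega : measurableType d) (R : realType)
    (P : probability Omega R) (X : nat * nat -> {mfun Omega >-> bool})
    (E : nat -> {mfun Omega >-> nat}) n k : R :=
  fine (P [set w | deaths (X ^~ w) (idle_cells (E ^~ w) n) == k]).

Section one_experiment.
Context d (Omega : measurableType d) (R : realType) (P : probability Omega R).
Variables (X : nat * nat -> {mfun Omega >-> bool}) (E : nat -> {mfun Omega >-> nat}).
Variables (G : probability nat R) (m1 m2 h : R) (n : nat).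
Let q := h / n%:R ^+ 2.
Hypothesis failure : forall i, P (X i @^-1` [set false]) = q%:E.
Hypothesis indepX : mutually_independent P (fun i => X i).
Hypothesis law : forall t, distribution P (E t) = G.
Hypothesis indepE : mutually_independent P (fun t => E t).
Hypothesis indepXE : independent_systems P (sigma_of X) (sigma_of E).
Hypothesis mean_G : (\int[G]_k (k%:R)%:E = m1%:E)%E.
Hypothesis moment2_G : (\int[G]_k (k%:R ^+ 2)%:E = m2%:E)%E.
Hypotheses (h0 : 0 <= h) (n0 : (0 < n)%N) (hn : h <= n%:R ^+ 2).

(** The limit of q times the mean number of idle cells, which is close to
    g(0) m1 n^2 / 2. *)
Definition idle_rate : R := mass G 0%N * m1 * h / 2.

Let s := (Num.sqrt n%:R)^-1 : R.
Let lam := idle_rate.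
Let V w := size (idle_cells (E ^~ w) n).
Let C := (m2 + 1) / 2 + 2 * m1.

Let nn0 : n%:R != 0 :> R. Proof. by rewrite pnatr_eq0 -lt0n. Qed.

Let r0 : 0 < Num.sqrt n%:R :> R. Proof. by rewrite sqrtr_gt0 ltr0n. Qed.

Let s2 : s ^+ 2 = n%:R^-1. Proof. by rewrite /s exprVn sqr_sqrtr. Qed.

Let q01 : 0 <= q <= 1.
Proof.
rewrite divr_ge0 ?exprn_ge0//= ler_pdivrMr ?mul1r//.
by rewrite exprn_gt0// ltr0n.
Qed.

Let q0 : 0 <= q. Proof. by case/andP: q01. Qed.

Let lam0 : 0 <= lam.
Proof. by rewrite divr_ge0// !mulr_ge0 ?fine_ge0// (mean_ge0 mean_G). Qed.

Let mV d' (S : measurableType d') (f : nat -> S) :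
  measurable_fun setT (fun w => f (V w)).
Proof.
apply: (measurable_environment E (n := n) (f := fun e => f (size (idle_cells e n)))).
by move=> e e' ee'; rewrite (depends_on_idle_cells ee').
Qed.

Lemma integral_rate_deviation :
  (\int[P]_w `|q * (V w)%:R - lam|%:E <= (h * C * s)%:E)%E.
Proof.
have qE w : `|q * (V w)%:R - lam|
    = q * `|(V w)%:R - mass G 0%N * m1 * n%:R ^+ 2 / 2|.
  rewrite -[X in X * `|_|](ger0_norm q0) -normrM; congr `|_|.
  by rewrite mulrBr /lam /idle_rate /q; congr (_ - _); field.
under eq_integral => w _ do rewrite qE EFinM.
rewrite ge0_integralZl ?lee_fin//; last first.
  by apply/measurable_EFinP; exact: (mV
    (fun v => `|v%:R - mass G 0%N * m1 * n%:R ^+ 2 / 2|)).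
apply: le_trans (lee_wpmul2l _ (integral_size_idle_cells_deviation law indepE
  mean_G moment2_G r0 (sqr_sqrtr (ler0n _ n)))) _; first by rewrite lee_fin.
rewrite -EFinM lee_fin /q /s -/C.
have -> : n%:R ^+ 2 = Num.sqrt n%:R ^+ 4 :> R.
  by rewrite -[in LHS](sqr_sqrtr (ler0n R n)); ring.
rewrite le_eqVlt; apply/orP; left; apply/eqP.
by field; rewrite gt_eqF.
Qed.

Lemma integral_squared_rate :
  (\int[P]_w (q ^+ 2 * (V w)%:R)%:E <= (h ^+ 2 * m1 * s ^+ 4)%:E)%E.
Proof.
apply: (@le_trans _ _ (\int[P]_w
    ((q ^+ 2 * n%:R)%:E * ((immigrants (E ^~ w) n)%:R)%:E))%E).
  apply: ge0_le_integral => //.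
  - by move=> w _; rewrite lee_fin mulr_ge0// sqr_ge0.
  - by apply/measurable_EFinP; exact: (mV (fun v => q ^+ 2 * v%:R)).
  - apply: emeasurable_funM => //; apply/measurable_EFinP.
    apply: (measurable_environment E (n := n)
      (f := fun e => (immigrants e n)%:R : R)) => e e' ee'.
    by rewrite (depends_on_immigrants _ ee').
  - move=> w _; rewrite -EFinM lee_fin -[leRHS]mulrA ler_wpM2l ?sqr_ge0//.
    rewrite -natrM ler_nat; apply: leq_trans (leq_size_cells _ _).
    by rewrite /V size_filter count_size.
rewrite ge0_integralZl ?lee_fin//; last 2 first.
- apply/measurable_EFinP.
  apply: (measurable_environment E (n := n)
    (f := fun e => (immigrants e n)%:R : R)) => e e' ee'.
  by rewrite (depends_on_immigrants _ ee').
- by rewrite mulr_ge0// sqr_ge0.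
rewrite (integral_immigrants law mean_G) -EFinM lee_fin.
have -> : s ^+ 4 = n%:R^-1 ^+ 2 by rewrite -s2; ring.
rewrite le_eqVlt; apply/orP; left; apply/eqP.
by rewrite /q; field.
Qed.

Local Notation a := (idle_deaths_pmf P X E n).

Let aE k : a k = \int[P]_w binomial_pmf (V w) q k.
Proof. by rewrite /idle_deaths_pmf (probability_idle_deaths failure indepX indepXE). Qed.

Let b_le1 k w : `|binomial_pmf (V w) q k| <= 1.
Proof.
by have /andP[b0 b1] := binomial_pmf_bounds (V w) k q01; rewrite ger0_norm.
Qed.

Let int_b k : P.-integrable setT (EFin \o (fun w => binomial_pmf (V w) q k)).
Proof.
apply: (@bounded_integrable _ _ _ _ _ 1) => //.
exact: (mV (fun v => binomial_pmf v q k)).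
Qed.

Lemma idle_deaths_pmf0 :
  `|a 0%N - expR (- lam)| <= h ^+ 2 * m1 * s ^+ 4 + h * C * s.
Proof.
have -> : a 0%N - expR (- lam)
    = \int[P]_w (binomial_pmf (V w) q 0 - expR (- lam)).
  rewrite RintegralB//; last first.
    by apply: (@bounded_integrable _ _ _ _ _ `|expR (- lam)|).
  by rewrite aE Rintegral_cst//= probability_setT mulr1.
apply: (normr_Rintegral_le (M := 1 + `|expR (- lam)|)
  (g := fun w => q ^+ 2 * (V w)%:R + `|q * (V w)%:R - lam|)).
- exact: (mV (fun v => binomial_pmf v q 0 - _)).
- exact: (mV (fun v => q ^+ 2 * v%:R + `|q * v%:R - lam|)).
- by move=> w; apply: le_trans (ler_normB _ _) _; rewrite lerD2r.
- by move=> w; exact: binomial_pmf0_expR.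
under eq_integral do rewrite EFinD.
rewrite ge0_integralD//.
- by rewrite EFinD leeD ?integral_squared_rate ?integral_rate_deviation.
- by move=> w _; rewrite lee_fin mulr_ge0// sqr_ge0.
- by apply/measurable_EFinP; exact: (mV (fun v => q ^+ 2 * v%:R)).
- by apply/measurable_EFinP; exact: (mV (fun v => `|q * v%:R - lam|)).
Qed.

(** The approximate Poisson recursion holds for each number V of idle cells, with
    an error linear in |q V - lam|, and is averaged over V. *)
Lemma idle_deaths_chen_stein k :
  `|k.+1%:R * a k.+1 - lam * a k| <= h * C * s + (2 * k%:R + 1) * h * s ^+ 4.
Proof.
have -> : k.+1%:R * a k.+1 - lam * a k = \int[P]_w
    (k.+1%:R * binomial_pmf (V w) q k.+1 - lam * binomial_pmf (V w) q k).
  rewrite RintegralB//; first by rewrite !aE !RintegralZl.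
  - apply: (@bounded_integrable _ _ _ _ _ k.+1%:R) => //.
      exact: (mV (fun v => k.+1%:R * binomial_pmf v q k.+1)).
    by move=> w; rewrite normrM normr_nat ler_piMr.
  - apply: (@bounded_integrable _ _ _ _ _ lam) => //.
      exact: (mV (fun v => lam * binomial_pmf v q k)).
    by move=> w; rewrite normrM (ger0_norm lam0) ler_piMr.
apply: (normr_Rintegral_le (M := k.+1%:R + lam)
  (g := fun w => `|q * (V w)%:R - lam| + (2 * k%:R + 1) * q)).
- exact: (mV (fun v => k.+1%:R * binomial_pmf v q k.+1 - lam * binomial_pmf v q k)).
- exact: (mV (fun v => `|q * v%:R - lam| + (2 * k%:R + 1) * q)).
- move=> w; apply: le_trans (ler_normB _ _) _; apply: lerD.
    by rewrite normrM normr_nat ler_piMr.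
  by rewrite normrM (ger0_norm lam0) ler_piMr.
- by move=> w; exact: binomial_pmf_chen_stein.
under eq_integral do rewrite EFinD.
rewrite ge0_integralD//; last 2 first.
- by apply/measurable_EFinP; exact: (mV (fun v => `|q * v%:R - lam|)).
- by move=> w _; rewrite lee_fin mulr_ge0.
rewrite integral_probability_cst EFinD leeD ?integral_rate_deviation// lee_fin.
have -> : s ^+ 4 = n%:R^-1 ^+ 2 by rewrite -s2; ring.
by rewrite /q -mulrA exprVn.
Qed.

(** Outside the exceptional event the two counts are equal. *)
Lemma drops_idle_deaths k K : (0 < K)%N ->
  measurable_fun setT (fun w => drops (X ^~ w) (E ^~ w) n) ->
  `|fine (P ((fun w => drops (X ^~ w) (E ^~ w) n) @^-1` [set k])) - a k| <=
  (h ^+ 2 * (m1 ^+ 2 + m2) + h * K%:R) * s ^+ 2 + h * m1 / K%:R.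
Proof.
move=> K0 mdrops.
have mB := measurable_exceptional_random X E K n.
have idleE : [set w | deaths (X ^~ w) (idle_cells (E ^~ w) n) == k]
    = (fun w => deaths (X ^~ w) (idle_cells (E ^~ w) n)) @^-1` [set k].
  by apply/seteqP; split=> w /= /eqP.
have mA := measurable_idle_deaths X E k n; rewrite idleE in mA.
rewrite /idle_deaths_pmf idleE; apply: le_trans
  (probability_change_of_variable P _ mA mB _) _ => [|w /negP|].
- by rewrite -[X in measurable X]setTI; exact: mdrops.
- rewrite /exceptional !negb_or => /and3P[twin few marg].
  by apply: (drops_deaths (K := K)); rewrite // leqNgt.
rewrite -lee_fin fineK ?fin_num_measure//.
apply: le_trans
  (probability_exceptional_random failure indepX indepXE n K0) _.
apply: le_trans (integral_exceptional_bound law indepE mean_G moment2_G h0 n0 K0) _.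
rewrite lee_fin s2 le_eqVlt; apply/orP; left; apply/eqP.
by ring.
Qed.

End one_experiment.

(** * Passage to the limit *)

Section limits.
Context {R : realType}.
Implicit Types (u v : R ^nat) (l : R).

Definition inv_sqrt n : R := (Num.sqrt n%:R)^-1.

Lemma cvg_inv_sqrt : inv_sqrt n @[n --> \oo] --> (0 : R).
Proof.
have inv_cvg : (n%:R^-1 : R) @[n --> \oo] --> (0 : R).
  by rewrite -(cvg_shiftS (fun n : nat => n%:R^-1 : R)); exact: cvg_harmonic.
have -> : inv_sqrt = (fun n => Num.sqrt (n%:R^-1)).
  by apply/funext => n; rewrite sqrtrV.
rewrite -[X in _ --> X]sqrtr0.
by apply: continuous_cvg inv_cvg; exact: sqrt_continuous.
Qed.

Lemma cvg_inv_sqrtX k : (0 < k)%N -> inv_sqrt n ^+ k @[n --> \oo] --> (0 : R).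
Proof.
case: k => // k _; elim: k => [|k IH]; first exact: cvg_inv_sqrt.
have := cvgM cvg_inv_sqrt IH; rewrite mulr0 => /(_ _).
by under [X in _ -> X]eq_cvg do rewrite exprS; apply.
Qed.

Lemma cvg_dist_le u v l : v n @[n --> \oo] --> (0 : R) ->
  (\forall n \near \oo, `|u n - l| <= v n) -> u n @[n --> \oo] --> l.
Proof.
move=> v0 uv; apply/cvgrPdist_le => e e0 /=.
have /cvgrPdist_le/(_ _ e0) v_le := v0.
near=> n; rewrite distrC; apply: (@le_trans _ _ (v n)); first by near: n.
by apply: le_trans (ler_norm _) _; rewrite -normrN -[- v n]add0r; near: n.
Unshelve. all: by end_near. Qed.

(** The recursion carries the limit from k to k + 1. Only the value at 0 has to
    be computed separately; the asymptotic Chen-Stein relation does the rest. *)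
Lemma poisson_pmf_cvg (a : nat -> R ^nat) (lam : R) :
  a 0%N n @[n --> \oo] --> expR (- lam) ->
  (forall k, k.+1%:R * a k.+1 n - lam * a k n @[n --> \oo] --> (0 : R)) ->
  forall k, a k n @[n --> \oo] --> lam ^+ k / k`!%:R * expR (- lam).
Proof.
move=> a0 step; elim=> [|k IH]; first by rewrite expr0 fact0 divr1 mul1r.
have kn0 : k.+1%:R != 0 :> R by rewrite pnatr_eq0.
have fn0 : k`!%:R != 0 :> R by rewrite pnatr_eq0 -lt0n fact_gt0.
rewrite (_ : a k.+1 = fun n => k.+1%:R^-1 *
    ((k.+1%:R * a k.+1 n - lam * a k n) + lam * a k n)); last first.
  by apply/funext => n; rewrite subrK mulKf.
rewrite (_ : lam ^+ k.+1 / _ * _ =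
    k.+1%:R^-1 * (0 + lam * (lam ^+ k / k`!%:R * expR (- lam)))); last first.
  rewrite exprS factS natrM; move: kn0 fn0.
  by move: (k.+1%:R) (k`!%:R) => x y x0 y0; field; rewrite x0 y0.
apply: cvgMl_tmp; apply: cvgD; first exact: step.
exact: cvgMl_tmp.
Qed.

End limits.

Section moments.
Context (R : realType) (G : probability nat R).

(** Both alternatives put mass on 0 and on 1, which makes g(0) and the mean
    positive. The second moment is bounded by M^2 for a support bounded by M, and
    is otherwise controlled by the variance, with k^2 <= 2 (k - m)^2 + 2 m^2. *)
Lemma assumption_moments : assumption_G G ->
  [/\ 0 < mass G 0%N, 0 < fine (mu_G G),
      (\int[G]_k (k%:R)%:E = (fine (mu_G G))%:E)%E
    & exists m2 : R, (\int[G]_k (k%:R ^+ 2)%:E = m2%:E)%E].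
Proof.
move=> hG.
have [g0 g1] : supp G 0%N /\ supp G 1%N.
  by case: hG => [[M M0 supE]|[supE _ _]]; rewrite supE.
rewrite /supp /= in g0 g1.
have massE k : (G [set k] = (mass G k)%:E)%E.
  by rewrite /mass fineK ?fin_num_measure.
have seriesE (f : nat -> R) : (forall k, 0 <= f k) ->
    (\int[G]_k (f k)%:E = \sum_(0 <= k <oo) (f k)%:E * (mass G k)%:E)%E.
  move=> f0; rewrite (ge0_integral_nat_valued G (tau := id) (f := EFin \o f))//.
  by apply: eq_eseriesr => k _; rewrite -massE.
have m_ge0 : (0 <= \int[G]_k (k%:R ^+ 2)%:E)%E.
  by apply: integral_ge0 => k _; rewrite lee_fin exprn_ge0.
have m2_fin : (\int[G]_k (k%:R ^+ 2)%:E < +oo)%E.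
  case: hG => [[M M0 supE]|[_ varG _]].
    apply: (@le_lt_trans _ _ (\int[G]_k (M%:R ^+ 2)%:E)%E); last first.
      by rewrite integral_probability_cst ltry.
    rewrite (seriesE (fun k => k%:R ^+ 2)) ?(seriesE (fun=> M%:R ^+ 2))//.
    apply: lee_nneseries => k _.
      by rewrite mule_ge0 ?lee_fin ?exprn_ge0// fine_ge0.
    have [kM|Mk] := leqP k M.
      by rewrite lee_wpmul2r ?lee_fin ?fine_ge0// ler_sqr ?nnegrE// ler_nat.
    suff -> : mass G k = 0 by rewrite !mule0.
    apply/eqP; rewrite eq_le fine_ge0// andbT leNgt; apply/negP => gk.
    by have : supp G k by []; rewrite supE /= leqNgt Mk.
  move: varG; rewrite /sigma2_G /variance unlock unlock.
  set m := fine _ => varG.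
  apply: (@le_lt_trans _ _ (\int[G]_k (2%:E * ((k%:R - m) * (k%:R - m))%:E
     + (2 * m ^+ 2)%:E))%E).
    apply: ge0_le_integral => //.
    - move=> k _; rewrite -EFinM -EFinD lee_fin.
      by have := sqr_ge0 (k%:R - 2 * m); nra.
  rewrite ge0_integralD//; last 2 first.
  - by move=> k _; rewrite mule_ge0 ?lee_fin// -expr2 sqr_ge0.
  - by move=> k _; rewrite lee_fin mulr_ge0// sqr_ge0.
  rewrite ge0_integralZl ?lee_fin//; last by move=> k _; rewrite lee_fin -expr2 sqr_ge0.
  rewrite integral_probability_cst lte_add_pinfty ?ltry//.
  by rewrite lte_mul_pinfty ?lee_fin.
have m2_fin_num : (\int[G]_k (k%:R ^+ 2)%:E)%E \is a fin_num by rewrite ge0_fin_numE.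
have mean_le : (\int[G]_k (k%:R)%:E <= \int[G]_k (k%:R ^+ 2)%:E)%E.
  apply: ge0_le_integral => //.
  by move=> k _; rewrite lee_fin -natrX ler_nat; case: k => // k; rewrite leq_pmulr.
have mean_ge : (G [set 1%N] <= \int[G]_k (k%:R)%:E)%E.
  rewrite -[X in G X]setIT -(integral_indic G measurableT)//.
  apply: ge0_le_integral => // k _.
  by rewrite lee_fin indicE in_set1; case: eqP => [->|].
have meanE : (\int[G]_k (k%:R)%:E = (fine (mu_G G))%:E)%E.
  rewrite /mu_G unlock fineK// ge0_fin_numE; first exact: le_lt_trans m2_fin.
  by apply: integral_ge0 => k _; rewrite lee_fin.
split=> //.
  by rewrite -lte_fin -meanE; apply: lt_le_trans mean_ge; rewrite massE lte_fin.
by exists (fine (\int[G]_k (k%:R ^+ 2)%:E)%E); rewrite fineK.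
Qed.

End moments.

Section inar_drops.
Context d (Omega : measurableType d).
Variables (Z : nat -> nat -> {mfun Omega >-> bool})
  (eps : nat -> {mfun Omega >-> nat}).

Definition survival (tj : nat * nat) : {mfun Omega >-> bool} := Z tj.1 tj.2.

Lemma population_inar w t : population (survival ^~ w) (eps ^~ w) t = inar Z eps t w.
Proof. by elim: t => //= t ->. Qed.

Definition inar_drops n w := drops (survival ^~ w) (eps ^~ w) n.

Lemma inar_dropsE n w :
  inar_drops n w = (\sum_(t < n) (inar Z eps t.+1 w < inar Z eps t w))%N.
Proof. by apply: eq_bigr => t _; rewrite !population_inar. Qed.

Lemma measurable_inar_drops n : measurable_fun setT (inar_drops n).
Proof.
rewrite (_ : inar_drops n = fun w =>
  (\sum_(t < n) (inar Z eps t.+1 w < inar Z eps t w))%N); last first.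
  by apply/funext => w; exact: inar_dropsE.
elim: n => [|n IH].
  by under eq_fun do rewrite big_ord0; exact: measurable_cst.
under eq_fun do rewrite big_ord_recr.
apply: measurable_fun_addn => //.
apply: (@measurableT_comp _ _ _ _ _ _ nat_of_bool) => //.
by apply: measurable_fun_ltn; exact: measurable_inar.
Qed.

HB.instance Definition _ n :=
  isMeasurableFun.Build _ _ _ _ (inar_drops n) (@measurable_inar_drops n).

Lemma hhat_inar_path (R : realType) (G : probability nat R) n w :
  hhat G (inar_path Z eps n w)
  = 2 / (mass G 0%N * fine (mu_G G)) * (inar_drops n w)%:R.
Proof.
rewrite /hhat inar_dropsE natr_sum mulrAC; congr (_ * _).
apply: eq_bigr => t _.
have pathE i : (i <= n)%N -> nth 0%N (inar_path Z eps n w) i = inar Z eps i w.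
  rewrite -ltnS => ilt; have := tnth_mktuple (fun i => inar Z eps i w) (Ordinal ilt).
  by rewrite (tnth_nth 0%N).
by rewrite !pathE// ltnW.
Qed.

End inar_drops.

Section limit_law.
Context (R : realType) (G : probability nat R).
Context d (Omega : measurableType d) (P : R -> probability Omega R).
Variables (Z : nat -> nat -> {mfun Omega >-> bool})
  (eps : nat -> {mfun Omega >-> nat}).
Hypothesis hP : forall theta : R, 0 <= theta <= 1 ->
  inar_innovations Z eps (P theta) G theta.
Variables (m1 m2 h : R).
Hypothesis mean_G : (\int[G]_k (k%:R)%:E = m1%:E)%E.
Hypothesis moment2_G : (\int[G]_k (k%:R ^+ 2)%:E = m2%:E)%E.
Hypothesis h0 : 0 <= h.

Let Pn n := P (1 - h / n%:R ^+ 2).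
Let lam := idle_rate G m1 h.
Let C := (m2 + 1) / 2 + 2 * m1.

Let admissible n := (0 < n)%N /\ h <= n%:R ^+ 2.

Let near_admissible : \forall n \near \oo, admissible n.
Proof.
near=> n; split; first by near: n; exact: nbhs_infty_gt.
have n1 : (0 < n)%N by near: n; exact: nbhs_infty_gt.
apply: (@le_trans _ _ n%:R); first by near: n; exact: nbhs_infty_ger.
by rewrite -natrX ler_nat -{1}(expn1 n) leq_pexp2l.
Unshelve. all: by end_near. Qed.

Let theta01 n : admissible n -> 0 <= 1 - h / n%:R ^+ 2 <= 1.
Proof.
move=> [n0 hn]; have n2 : 0 < n%:R ^+ 2 :> R by rewrite exprn_gt0// ltr0n.
by rewrite subr_ge0 ler_pdivrMr// mul1r hn gerBl divr_ge0// ltW.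
Qed.

Let failure n : admissible n -> forall i,
  Pn n (survival Z i @^-1` [set false]) = (h / n%:R ^+ 2)%:E.
Proof.
move=> /theta01 th [t j]; have [/(_ t j) lawZ _ _ _ _] := hP th.
rewrite -[LHS]/(distribution (Pn n) (Z t j) [set false]) /Pn lawZ.
rewrite bernoulli_probE// !diracE !in_set1 /= mule0 add0e mule1.
by congr EFin; exact: subKr.
Qed.

(** The estimates for one experiment require n > 0 and h <= n^2, that is, a
    parameter in [0, 1]; both hold eventually. *)
Lemma idle_deaths_pmf_cvg k :
  idle_deaths_pmf (Pn n) (survival Z) eps n k @[n --> \oo]
    --> lam ^+ k / k`!%:R * expR (- lam).
Proof.
apply: (poisson_pmf_cvg (a := fun k n => idle_deaths_pmf (Pn n) (survival Z) eps n k)) => [|{}k] /=.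
  apply: (cvg_dist_le (v := fun n =>
    h ^+ 2 * m1 * inv_sqrt n ^+ 4 + h * C * inv_sqrt n)).
    rewrite -[X in _ --> X](_ : h ^+ 2 * m1 * 0 + h * C * 0 = 0 :> R); last by ring.
    apply: cvgD; apply: cvgMl_tmp; first exact: cvg_inv_sqrtX.
    exact: cvg_inv_sqrt.
  apply: filterS near_admissible => n adm; have [n0 hn] := adm.
  have [_ indepZ law_eps indep_eps indepZE] := hP (theta01 adm).
  exact: (idle_deaths_pmf0 (failure adm) indepZ law_eps indep_eps indepZE
    mean_G moment2_G h0 n0 hn).
apply: (cvg_dist_le (v := fun n =>
    h * C * inv_sqrt n + (2 * k%:R + 1) * h * inv_sqrt n ^+ 4)).
  rewrite -[X in _ --> X](_ : h * C * 0 + (2 * k%:R + 1) * h * 0 = 0 :> R); last by ring.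
  apply: cvgD; apply: cvgMl_tmp; last exact: cvg_inv_sqrtX.
  exact: cvg_inv_sqrt.
apply: filterS near_admissible => n adm; have [n0 hn] := adm.
have [_ indepZ law_eps indep_eps indepZE] := hP (theta01 adm).
rewrite subr0; exact: (idle_deaths_chen_stein (failure adm) indepZ law_eps
  indep_eps indepZE mean_G moment2_G h0 n0 hn).
Qed.

Lemma inar_drops_pmf_cvg k :
  mass (distribution (Pn n) (inar_drops Z eps n)) k @[n --> \oo]
    --> mass (poisson_prob lam 0) k.
Proof.
have m10 := mean_ge0 mean_G.
have lam0 : 0 <= lam by rewrite divr_ge0// !mulr_ge0// fine_ge0.
have -> : mass (poisson_prob lam 0) k = lam ^+ k / k`!%:R * expR (- lam).
  by rewrite /mass /= poisson_prob1.
set a := fun n => idle_deaths_pmf (Pn n) (survival Z) eps n k.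
suff diff : mass (distribution (Pn n) (inar_drops Z eps n)) k - a n @[n --> \oo]
    --> (0 : R).
  have := cvgD diff (@idle_deaths_pmf_cvg k); rewrite add0r => /(_ _).
  apply: cvg_trans; apply: near_eq_cvg; apply: nearW => n /=.
  by rewrite subrK.
apply/cvgrPdist_le => e e0.
(* The truncation level K is fixed first, so that the probability of more than
   K deaths is small uniformly in n. *)
pose K := (Num.truncn (2 * (h * m1) / e)).+1.
have K0 : 0 < K%:R :> R by [].
have KE : h * m1 / K%:R <= e / 2.
  have : 2 * (h * m1) / e < K%:R by exact: truncnS_gt.
  by rewrite ltr_pdivrMr// ler_pdivrMr// => ?; lra.
near=> n.
have adm : admissible n by near: n.
have [n0 hn] := adm.
have [_ indepZ law_eps indep_eps indepZE] := hP (theta01 adm).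
rewrite sub0r normrN.
apply: le_trans (drops_idle_deaths (failure adm) indepZ law_eps indep_eps indepZE
  mean_G moment2_G h0 n0 k (ltn0Sn _ : (0 < K)%N) (measurable_inar_drops Z eps n)) _.
rewrite [leRHS](splitr e); apply: lerD => //.
apply: le_trans (ler_norm _) _; rewrite -normrN -[- _]add0r.
near: n.
have : (h ^+ 2 * (m1 ^+ 2 + m2) + h * K%:R) * inv_sqrt n ^+ 2 @[n --> \oo]
    --> (h ^+ 2 * (m1 ^+ 2 + m2) + h * K%:R) * 0.
  by apply: cvgMl_tmp; exact: cvg_inv_sqrtX.
by rewrite mulr0 => /cvgrPdist_le; apply; rewrite divr_gt0.
Unshelve. all: by end_near. Qed.

End limit_law.

Lemma bounded_funP (R : realType) (f : R -> R) : bounded_fun f ->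
  exists M, forall x, `|f x| <= M.
Proof.
by move=> [M [_ fM]]; exists (M + 1) => x; apply: fM => //; rewrite ltrDl.
Qed.

Local Close Scope classical_set_scope.

Theorem corollary4p2 (R : realType) (G : probability nat R)
    (hG : assumption_G G)
    (d : measure_display) (Omega : measurableType d)
    (P : R -> probability Omega R)
    (Z : nat -> nat -> {mfun Omega >-> bool})
    (eps : nat -> {mfun Omega >-> nat})
    (hP : forall theta : R, 0 <= theta <= 1 ->
       inar_innovations Z eps (P theta) G theta) :
  efficient G (inar_experiment Z eps P) (fun n => hhat G (n := n)).
Proof.
have [g0 mu0 meanE [m2 m2E]] := assumption_moments hG.
set m1 := fine (mu_G G) in mu0 meanE.
(* The estimator is c times the number of drops. *)
pose c : R := 2 / (mass G 0%N * m1).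
have c0 : 0 <= c by rewrite divr_ge0// mulr_ge0// ltW.
have mscale : measurable_fun setT (fun k : nat => c * k%:R : R) by [].
pose scale : {mfun nat >-> R} := HB.pack (fun k : nat => c * k%:R : R)
  (isMeasurableFun.Build _ _ _ _ _ mscale).
exists (fun h => distribution (poisson_prob (idle_rate G m1 h) 0) scale) => h h0.
set lam := idle_rate G m1 h.
have lam0 : 0 <= lam by rewrite divr_ge0// !mulr_ge0// ltW.
have c_lam : c * lam = h.
  by rewrite /c /lam /idle_rate; field; rewrite !gt_eqF.
split.
- move=> f cont_f /bounded_funP[M fM].
  have mf : measurable_fun setT f by exact: continuous_measurable_fun.
  have gM k : `|f (c * k%:R)| <= M by exact: fM.
  rewrite (expectation_bounded _ mf fM) (Rintegral_distribution _ _ mf fM).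
  rewrite (_ : (fun n => _) = fun n =>
    (\int[distribution (P (1 - h / n%:R ^+ 2)) (inar_drops Z eps n)]_k
       f (c * k%:R))%:E); last first.
    apply/funext => n; rewrite (expectation_bounded _ mf fM).
    rewrite (Rintegral_distribution _ _ mf fM).
    rewrite (@Rintegral_distribution _ _ _ _ _ _ _ (f \o hhat G (n := n)) M)//.
      rewrite (@Rintegral_distribution _ _ _ _ _ _ _ (fun k => f (c * k%:R)) M)//.
      by congr EFin; apply: eq_Rintegral => w _; rewrite /= hhat_inar_path.
      exact: (measurableT_comp mf (measurable_funPT (hhat G (n := n)))).
    by move=> x; exact: fM.
  apply/cvg_EFin; first exact: nearW.
  apply: (pmf_cvg_bounded_integral (g := fun k => f (c * k%:R)) (M := M)) gM => k.
  exact: (inar_drops_pmf_cvg hP meanE m2E h0).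
- have mean_scale : (\int[poisson_prob lam 0]_k (c * k%:R)%:E = h%:E)%E.
    under eq_integral do rewrite EFinM.
    rewrite ge0_integralZl ?lee_fin//.
    by rewrite [X in (_ * X)%E](poisson_mean 0 lam0) -EFinM c_lam.
  rewrite integral_distribution//.
  apply/integrableP; split; first by [].
  rewrite (eq_integral (fun k => (c * k%:R)%:E)) ?mean_scale ?ltry// => k _.
  by rewrite /= ger0_norm// mulr_ge0.
- rewrite ge0_integral_distribution.
  + rewrite -[in LHS]c_lam [LHS](poisson_affine_variance 0 lam0 c0).
    by congr EFin; rewrite expr2 -mulrA c_lam /c mulrAC.
  + apply/measurable_EFinP; apply: measurable_funX.
    exact: measurable_funB.
  + by move=> z; rewrite lee_fin sqr_ge0.
Qed.
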